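(* Let $(V,E)$ be a simple graph with countable (finite or countably infinite) vertex set, and for each $u\in V$ let $G_u\in\mathcal{G}_{\mathrm{plin}}$. Then the graph product of $(G_u)_{u\in V}$ over $(V,E)$ belongs to $\mathcal{G}_{\mathrm{bnd},\Sigma}$ for every alphabet $\Sigma$. Moreover, it embeds in $\llbracket\Sigma^{\mathbb{Z}}\rrbracket$ with linear look-ahead, and with bounded look-ahead when $V$ is finite.
   Context: An alphabet is a finite set with at least two elements. $\llbracket\Sigma^{\mathbb{Z}}\rrbracket$ is the group of homeomorphisms $f$ of $\Sigma^{\mathbb{Z}}$ with a continuous cocycle $c:\Sigma^{\mathbb{Z}}\to\mathbb{Z}$ such that $f(x)=\sigma^{c(x)}(x)$, where $\sigma(x)_i=x_{i+1}$. Write $[w]_i=\{x:x_{[i,i+|w|-1]}=w\}$. A subgroup $G\le\llbracket\Sigma^{\mathbb{Z}}\rrbracket$ has look-ahead $\alpha:\mathbb{N}\to\mathbb{N}$ if $\alpha(0)=0$ and for every non-identity $g\in G$ with cocycle $c$ there exist $n\ge1$, $w\in\Sigma^{2n+1}$ and $m\in\mathbb{Z}$ with $c(x)=m$ for all $x\in[w]_{-n}$ and $|m|+\alpha(|m|)\ge n$; it has plook-ahead $\alpha$ if $\alpha(0)=0$ and for every non-identity $g\in G$ with cocycle $c$ there are $n\ge1$ and a point $x$ with $\sigma^p(x)=x$ for some $1\le p\le 2n+1$ and $|c(x)|+\alpha(|c(x)|)\ge n$. $\alpha$ is linear if $\alpha(n)\le Cn+C$ for some $C$, bounded if it is a bounded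 function. $\mathcal{G}_{\mathrm{plin}}$ is the class of groups isomorphic to a subgroup of some $\llbracket\Sigma^{\mathbb{Z}}\rrbracket$ with linear plook-ahead; $\mathcal{G}_{\mathrm{bnd},\Sigma}$ the class of groups isomorphic to a subgroup of $\llbracket\Sigma^{\mathbb{Z}}\rrbracket$ with bounded look-ahead. The graph product of groups $(G_u)_{u\in V}$ over $(V,E)$ is the free product $*_{u\in V}G_u$ modulo the relations $[g,h]=1$ for all $g\in G_u$, $h\in G_{u'}$ with $\{u,u'\}\in E$. *)

(* Defs.v *)
From mathcomp Require Import all_boot all_order all_algebra.
From Stdlib Require List.
Set Implicit Arguments. Unset Strict Implicit. Unset Printing Implicit Defensive.
Import Order.TTheory GRing.Theory Num.Theory.
Local Open Scope ring_scope.

Record group := Group {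
  gcar :> Type;
  gmul : gcar -> gcar -> gcar;
  gone : gcar;
  ginv : gcar -> gcar;
  gmulA : forall a b c, gmul a (gmul b c) = gmul (gmul a b) c;
  gmul1 : forall a, gmul gone a = a;
  gmulV : forall a, gmul (ginv a) a = gone
}.

Definition is_hom (G H : group) (f : G -> H) : Prop :=
  forall a b, f (gmul a b) = gmul (f a) (f b).

Definition simple_graph (V : Type) (E : V -> V -> Prop) : Prop :=
  (forall u v, E u v -> E v u) /\ (forall u, ~ E u u).

Definition countable_type (V : Type) : Prop :=
  exists f : V -> nat, forall u v, f u = f v -> u = v.

Definition finite_type (V : Type) : Prop :=
  exists l : seq V, forall v, List.In v l.

(** * Graph product, characterised by the universal property of the
    presentation  ( *_u G_u ) / << [g,h] : g in G_u, h in G_u', {u,u'} in E >> *)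
Definition commuting_family (V : Type) (E : V -> V -> Prop) (G : V -> group)
  (Q : group) (f : forall u, G u -> Q) : Prop :=
  forall u u' (g : G u) (h : G u'), E u u' ->
    gmul (f u g) (f u' h) = gmul (f u' h) (f u g).

Unset Implicit Arguments.
Definition is_graph_product (V : Type) (E : V -> V -> Prop) (G : V -> group)
  (P : group) (iota : forall u, G u -> P) : Prop :=
  (forall u, is_hom (iota u)) /\ commuting_family E iota /\
  forall (Q : group) (f : forall u, G u -> Q),
    (forall u, is_hom (f u)) -> commuting_family E f ->
    (exists F : P -> Q, is_hom F /\ forall u g, F (iota u g) = f u g) /\
    (forall F1 F2 : P -> Q, is_hom F1 -> is_hom F2 ->
       (forall u g, F1 (iota u g) = f u g) ->
       (forall u g, F2 (iota u g) = f u g) -> forall p, F1 p = F2 p).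

Set Implicit Arguments.

Section Shift.
Variable S : finType.

Definition alphabet : Prop := (1 < #|S|)%N.

Definition point := int -> S.

Definition shift (k : int) (x : point) : point := fun i => x (i + k).

Definition agree (n : nat) (x y : point) : Prop :=
  forall i : int, - (n%:Z) <= i <= n%:Z -> x i = y i.

(* continuity for the product topology (cylinder basis) *)
Definition cont_map (f : point -> point) : Prop :=
  forall (x : point) (m : nat), exists n : nat,
    forall y, agree n x y -> agree m (f x) (f y).

(* continuity of a map into the discrete space Z *)
Definition cont_cocycle (c : point -> int) : Prop :=
  forall x : point, exists n : nat, forall y, agree n x y -> c y = c x.

Definition homeo (f : point -> point) : Prop :=
  cont_map f /\ exists g : point -> point, cont_map g /\
    (forall x i, g (f x) i = x i) /\ (forall x i, f (g x) i = x i).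

Definition is_cocycle_of (f : point -> point) (c : point -> int) : Prop :=
  cont_cocycle c /\ forall x i, f x i = shift (c x) x i.

Definition in_TFG (f : point -> point) : Prop :=
  homeo f /\ exists c, is_cocycle_of f c.

Definition nonidentity (f : point -> point) : Prop :=
  exists x i, f x i <> x i.

Definition in_cyl (k : nat) (w : k.-tuple S) (i : int) (x : point) : Prop :=
  forall j : 'I_k, x (i + (j : nat)%:Z) = tnth w j.

Definition has_lookahead (H : (point -> point) -> Prop) (alpha : nat -> nat) : Prop :=
  alpha 0%N = 0%N /\
  forall g, H g -> nonidentity g -> forall c, is_cocycle_of g c ->
    exists n : nat, (1 <= n)%N /\
    exists (w : (2 * n + 1).-tuple S) (m : int),
      (forall x, in_cyl w (- (n%:Z)) x -> c x = m) /\
      (n <= `|m| + alpha `|m|)%N.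

Definition has_plookahead (H : (point -> point) -> Prop) (alpha : nat -> nat) : Prop :=
  alpha 0%N = 0%N /\
  forall g, H g -> nonidentity g -> forall c, is_cocycle_of g c ->
    exists n : nat, (1 <= n)%N /\
    exists (x : point) (p : nat), (1 <= p <= 2 * n + 1)%N /\
      (forall i, shift p%:Z x i = x i) /\
      (n <= `|c x| + alpha `|c x|)%N.

Definition embeds_with (G : group)
  (LA : ((point -> point) -> Prop) -> (nat -> nat) -> Prop)
  (A : (nat -> nat) -> Prop) : Prop :=
  exists phi : G -> (point -> point),
    (forall g, in_TFG (phi g)) /\
    (forall a b x i, phi (gmul a b) x i = phi a (phi b x) i) /\
    (forall a b, (forall x i, phi a x i = phi b x i) -> a = b) /\
    exists alpha, A alpha /\ LA (fun f => exists g, f = phi g) alpha.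

End Shift.

Definition linear_fun (alpha : nat -> nat) : Prop :=
  exists C : nat, forall n, (alpha n <= C * n + C)%N.

Definition bounded_fun (alpha : nat -> nat) : Prop :=
  exists B : nat, forall n, (alpha n <= B)%N.

Definition in_Gplin (G : group) : Prop :=
  exists S : finType, alphabet S /\ embeds_with G (@has_plookahead S) linear_fun.

Definition in_Gbnd (S : finType) (G : group) : Prop :=
  embeds_with G (@has_lookahead S) bounded_fun.

(* Main.v *)
(** A tape over [S] is cut by self-synchronising binary codewords, the edges.
    An edge belongs to a vertex [u], and consecutive edges of [u] are linked
    into a conveyor belt of cells: the head travels to the right along the
    forward cells and comes back along the return cells.  Every cell carries a
    letter of the alphabet on which [G u] acts, so that [G u] acts on tapes by
    moving the head along the belts of [u]; belts of adjacent vertices never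
    share a cell, whence an action of the graph product.

    Let [g] be a nontrivial element of [G u], moving a [p]-periodic point by
    [m] with [p] linear in [|m|].  Choose a multiple [P] of [p] which is larger
    than [2|m|] and still linear in [|m|].  Then the periodic point fits on a
    belt with [m mod P] forward and [-m mod P] return steps, having a bounded
    number of each per edge, and [g] carries the head from the left end of
    this belt exactly to its right end.

    A nontrivial element is represented by a reduced word.  Going back from the
    last acting letter [g_1], and jumping each time to the nearest letter that
    does not commute with the current one, one gets letters whose belts, put
    side by side and sharing their ends, form a tape of length [M] which the
    word crosses entirely.  The other letters do not move the head on their
    turn, so the cocycle is [M] on a cylinder of radius [M]: the look-ahead
    function [0] works for every countable graph. *)

Require Import Defs.
From mathcomp Require Import all_boot all_order all_algebra.
From mathcomp Require Import zify.
From Stdlib Require Import Classical ClassicalEpsilon FunctionalExtensionality.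
From Stdlib Require Import PropExtensionality ProofIrrelevance.
Set Implicit Arguments. Unset Strict Implicit. Unset Printing Implicit Defensive.
Import Order.TTheory GRing.Theory Num.Theory.
Local Open Scope ring_scope.

(** * Conveyor belts *)

Definition opick (T : Type) (Q : T -> Prop) : option T :=
  match excluded_middle_informative (exists t, Q t) with
  | left h => Some (proj1_sig (constructive_indefinite_description Q h))
  | right _ => None
  end.

Variant opick_spec (T : Type) (Q : T -> Prop) : option T -> Prop :=
| OpickSome t of Q t : opick_spec Q (Some t)
| OpickNone of (forall t, ~ Q t) : opick_spec Q None.

Lemma opickP (T : Type) (Q : T -> Prop) : opick_spec Q (opick Q).
Proof.
rewrite /opick; case: excluded_middle_informative => [h|h].
  by constructor; case: constructive_indefinite_description.
by constructor => t Qt; apply: h; exists t.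
Qed.

Lemma opick_uniq (T : Type) (Q : T -> Prop) t :
  Q t -> (forall t', Q t' -> t' = t) -> opick Q = Some t.
Proof. by move=> Qt U; case: opickP => [t' /U->|/(_ t)]. Qed.

Lemma opick_none (T : Type) (Q : T -> Prop) :
  (forall t, ~ Q t) -> opick Q = None.
Proof. by move=> U; case: opickP => // t /U. Qed.

Section Zpow.
Variables (T : Type) (s s' : T -> T).

Definition zpow (k : int) (p : T) : T :=
  match k with Posz n => iter n s p | Negz n => iter n.+1 s' p end.

Lemma zpow_fix p k : s p = p -> s' p = p -> zpow k p = p.
Proof.
move=> h h'.
have hi n (t : T -> T) : t p = p -> iter n t p = p by move=> ht; elim: n => //= n ->.
by case: k => n; rewrite /zpow hi.
Qed.

Lemma zpow_ind (Q : T -> Prop) p k :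
  (forall q, Q q -> Q (s q)) -> (forall q, Q q -> Q (s' q)) -> Q p -> Q (zpow k p).
Proof.
by move=> hs hs' hp; case: k => n; rewrite /zpow; elim: n => /= *; auto.
Qed.

Hypotheses (sK : cancel s s') (s'K : cancel s' s).

Lemma zpow_succ k p : zpow (k + 1) p = s (zpow k p).
Proof.
case: k => [n|[|n]].
- by have -> : Posz n + 1 = Posz n.+1 by lia.
- by rewrite /= s'K.
- have -> : Negz n.+1 + 1 = Negz n by lia.
  by rewrite /= s'K.
Qed.

Lemma zpow_pred k p : zpow (k - 1) p = s' (zpow k p).
Proof. by rewrite -[in RHS](subrK 1 k) zpow_succ sK. Qed.

Lemma zpowD k l p : zpow (k + l) p = zpow k (zpow l p).
Proof.
case: k => n.
  elim: n => [|n IH]; first by rewrite add0r.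
  have -> : Posz n.+1 + l = Posz n + l + 1 by lia.
  by rewrite zpow_succ IH.
elim: n => [|n IH].
  have -> : Negz 0 + l = l - 1 by lia.
  by rewrite zpow_pred.
have -> : Negz n.+1 + l = Negz n + l - 1 by lia.
by rewrite zpow_pred IH.
Qed.

Lemma zpow_period (P : nat) p k :
  iter P s p = p -> zpow (k * P%:Z) p = p.
Proof.
move=> hP; have hP' : zpow P%:Z p = p by [].
have hN : zpow (- P%:Z) p = p by rewrite -[in LHS]hP' -zpowD addNr.
case: k => n.
  elim: n => [|n IH]; first by rewrite mul0r.
  have -> : Posz n.+1 * P%:Z = Posz n * P%:Z + P%:Z by rewrite intS mulrDl mul1r addrC.
  by rewrite zpowD hP' IH.
elim: n => [|n IH].
  by have -> : Negz 0 * P%:Z = - P%:Z by rewrite NegzE mulN1r.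
have -> : Negz n.+1 * P%:Z = Negz n * P%:Z + - P%:Z.
  by rewrite !NegzE [in LHS]intS opprD mulrDl mulN1r addrC.
by rewrite zpowD hN IH.
Qed.

End Zpow.

(* An edge is the list [N :: a :: b :: labels]: index of its vertex, number of forward steps, number of return steps, labels of the forward cells and then of the return cells. Its codeword is [1 1 0^(q+1) 1 0] with [q] its [CodeSeq.code], hence the length [q + 5]. *)
Definition esrc (e : seq nat) := nth 0%N e 0.
Definition efwd (e : seq nat) := nth 0%N e 1.
Definition ebwd (e : seq nat) := nth 0%N e 2.
Definition elen (e : seq nat) : nat := (CodeSeq.code e + 5)%N.
Definition eslen (es : seq (seq nat)) : nat := sumn (map elen es).

(** [nside] is [true] on forward cells, and [nidx] counts in the order of travel. Only the order
    along the belt matters: the tape positions given by [npos] need not follow it. *)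
Record node := Node { nstart : int; nedge : seq nat; nside : bool; nidx : nat }.

Definition node_shift (k : int) (n : node) : node :=
  Node (nstart n + k) (nedge n) (nside n) (nidx n).

Definition node_label (n : node) : nat :=
  nth 0%N (nedge n) (3 + (if nside n then 0 else efwd (nedge n)) + nidx n).

Section Conveyor.
Variable Ed : int -> seq nat -> Prop.

Definition on_belt (n : node) : Prop :=
  Ed (nstart n) (nedge n) /\
  (nidx n < if nside n then efwd (nedge n) else ebwd (nedge n))%N.

Definition redge (i : int) (e : seq nat) : option (seq nat) :=
  opick (fun e' => Ed (i + (elen e)%:Z) e').

Definition ledge (i : int) : option (int * seq nat) :=
  opick (fun ie : int * seq nat => Ed ie.1 ie.2 /\ ie.1 + (elen ie.2)%:Z = i).

Definition nxt (n : node) : node :=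
  let: Node i e sd k := n in
  if sd then
    if (k.+1 < efwd e)%N then Node i e true k.+1 else
    if redge i e is Some e' then Node (i + (elen e)%:Z) e' true 0
    else Node i e false 0
  else
    if (k.+1 < ebwd e)%N then Node i e false k.+1 else
    if ledge i is Some (i', e') then Node i' e' false 0
    else Node i e true 0.

Definition prv (n : node) : node :=
  let: Node i e sd k := n in
  if k is k'.+1 then Node i e sd k' else
  if sd then
    if ledge i is Some (i', e') then Node i' e' true (efwd e').-1
    else Node i e false (ebwd e).-1
  else
    if redge i e is Some e' then Node (i + (elen e)%:Z) e' false (ebwd e').-1
    else Node i e true (efwd e).-1.

(* The first return cell of an edge sits inside the edge when the belt continues to the right, and is the right end of the edge when the belt turns around there. *)
Definition npos (n : node) : int :=
  let: Node i e sd k := n in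
  if sd then i + k%:Z else
  if k is 0 then i + (if redge i e is Some _ then efwd e else elen e)%:Z
  else i + (efwd e + k)%:Z.

Definition nloc (p : int) : option node :=
  opick (fun n => on_belt n /\ npos n = p).

Definition belt (p : int) : int := if nloc p is Some n then npos (nxt n) else p.
Definition tleb (p : int) : int := if nloc p is Some n then npos (prv n) else p.
Definition blab (p : int) : nat := if nloc p is Some n then node_label n else 0%N.

Hypothesis Ed_pos : forall i e, Ed i e ->
  [/\ (0 < efwd e)%N, (0 < ebwd e)%N & (efwd e + ebwd e <= elen e)%N].
Hypothesis Ed_sep : forall i e i' e', Ed i e -> Ed i' e' ->
  i <= i' < i + (elen e)%:Z -> i = i' /\ e = e'.

Lemma elen_gt0 e : (0 < elen e)%N. Proof. by rewrite /elen addnS. Qed.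

Lemma Ed_fun i e e' : Ed i e -> Ed i e' -> e = e'.
Proof. by move=> h h'; case: (Ed_sep h h') => //; have := elen_gt0 e; lia. Qed.

Lemma Ed_end_fun i e i' e' : Ed i e -> Ed i' e' ->
  i + (elen e)%:Z = i' + (elen e')%:Z -> i = i' /\ e = e'.
Proof.
move=> h h' eq; have := elen_gt0 e; have := elen_gt0 e' => l l'.
case: (lerP i i') => hi; first by apply: (Ed_sep h h'); lia.
by case: (Ed_sep h' h) => [|-> ->] //; lia.
Qed.

Lemma redge_some i e e' : Ed (i + (elen e)%:Z) e' -> redge i e = Some e'.
Proof. by move=> h; apply: opick_uniq => // t /Ed_fun; apply. Qed.

Lemma ledge_some i e i' : Ed i' e -> i' + (elen e)%:Z = i -> ledge i = Some (i', e).
Proof.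
move=> h hi; apply: opick_uniq => //= -[j e'] /= [h' hj].
by case: (Ed_end_fun h h'); [lia | move=> -> ->].
Qed.

Lemma nxt_on n : on_belt n -> on_belt (nxt n).
Proof.
case: n => i e sd k [/= he hk]; have [ha hb _] := Ed_pos he.
case: sd hk => hk; case: ifP => // _.
  rewrite /redge; case: opickP => [e' he'|_]; split => //=.
  by case: (Ed_pos he').
rewrite /ledge; case: opickP => [[i' e'] [he' _]|_]; split => //=.
by case: (Ed_pos he').
Qed.

Lemma prv_on n : on_belt n -> on_belt (prv n).
Proof.
case: n => i e sd [|k] [/= he hk]; have [ha hb _] := Ed_pos he; last first.
  by split => //; case: sd hk => /= hk; lia.
case: sd hk => hk.
  rewrite /ledge; case: opickP => [[i' e'] [he' _]|_]; split => //=; last by lia.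
  by case: (Ed_pos he') => /=; lia.
rewrite /redge; case: opickP => [e' he'|_]; split => //=; last by lia.
by case: (Ed_pos he'); lia.
Qed.

(** Belts neither branch nor merge: the separation of edges makes the edge beyond each end unique,
    so a junction can be crossed back, and a turn at a free end is undone because the same neighbour
    is missing. *)
Lemma nxtK n : on_belt n -> prv (nxt n) = n.
Proof.
case: n => i e sd k [/= he hk]; have [ha hb _] := Ed_pos he.
case: sd hk => hk; case: ifP => //= hk'.
  case hr : (redge i e) => [e'|] /=.
    by rewrite (ledge_some he (erefl _)); congr Node; lia.
  by rewrite hr; congr Node; lia.
move: (erefl (ledge i)); rewrite {1}/ledge; case: opickP => [[i' e'] [/= he' hi]|_] hl; rewrite -hl /=.
  have hr : redge i' e' = Some e by apply: redge_some; rewrite hi.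
  by rewrite hr hi; congr Node; lia.
by rewrite -hl; congr Node; lia.
Qed.

Lemma prvK n : on_belt n -> nxt (prv n) = n.
Proof.
case: n => i e sd [|k] [/= he hk]; have [ha hb _] := Ed_pos he; last first.
  by rewrite /=; case: sd hk => ->.
case: sd hk => hk.
  move: (erefl (ledge i)); rewrite {1}/ledge.
  case: opickP => [[i' e'] [/= he' hi]|_] hl /=; have hl' := esym hl.
    have hr : redge i' e' = Some e by apply: redge_some; rewrite hi.
    have [ha' _ _] := Ed_pos he'.
    by rewrite hl' /= prednK // ltnn hr hi.
  by rewrite hl' /= prednK // ltnn hl'.
case hr : (redge i e) => [e'|] /=; last by rewrite prednK // ltnn hr.
have he' : Ed (i + (elen e)%:Z) e' by move: hr; rewrite /redge; case: opickP => // t ht [<-].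
by have [_ hb' _] := Ed_pos he'; rewrite prednK // ltnn (ledge_some he (erefl _)).
Qed.

(** Only a turning cell can lie outside the half-open span of its edge. It then sits at the right
    end, where no edge starts. *)
Lemma npos_range n : on_belt n ->
  nstart n <= npos n < nstart n + (elen (nedge n))%:Z \/
  npos n = nstart n + (elen (nedge n))%:Z /\
    (forall e', ~ Ed (nstart n + (elen (nedge n))%:Z) e').
Proof.
case: n => i e sd k [/= he hk]; have [ha hb hab] := Ed_pos he.
case: sd hk => hk; first by left; lia.
case: k hk => [|k] hk; last by left; lia.
by rewrite /redge; case: opickP => [e' he'|no]; [left; lia | right].
Qed.

(** Spans of distinct edges are disjoint, so both cells belong to one edge. There the forward cells
    have offsets below [efwd e], the return cells offsets from [efwd e] to below [efwd e + ebwd e],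
    and a turning cell has offset [elen e], which exceeds those of all the others. *)
Lemma npos_inj n n' : on_belt n -> on_belt n' -> npos n = npos n' -> n = n'.
Proof.
move=> h h' eqp.
have [hs he] : nstart n = nstart n' /\ nedge n = nedge n'.
  case: (npos_range h) (npos_range h') => [r|[r nr]] [r'|[r' nr']];
    case: h h' => h _ [h' _].
  - case: (lerP (nstart n) (nstart n')) => hi; first by apply: (Ed_sep h h'); lia.
    by case: (Ed_sep h' h) => [|-> ->] //; lia.
  - case: (lerP (nstart n) (nstart n')) => hi; first by apply: (Ed_sep h h'); lia.
    case: (ltrP (nstart n) (nstart n' + (elen (nedge n'))%:Z)) => hj.
      by case: (Ed_sep h' h) => [|-> ->] //; lia.
    by case: (nr' (nedge n)); have <- : nstart n = nstart n' + (elen (nedge n'))%:Z by lia.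
  - case: (lerP (nstart n) (nstart n')) => hi; last by case: (Ed_sep h' h) => [|-> ->] //; lia.
    case: (ltrP (nstart n') (nstart n + (elen (nedge n))%:Z)) => hj.
      by apply: (Ed_sep h h'); lia.
    by case: (nr (nedge n')); have <- : nstart n' = nstart n + (elen (nedge n))%:Z by lia.
  - by apply: (Ed_end_fun h h'); lia.
case: n n' h h' eqp hs he => i e sd k [i' e' sd' k'] [/= he hk] [/= _ hk'] + ei ee; subst i' e'.
have [ha hb hab] := Ed_pos he.
by case: sd sd' hk hk' => -[] hk hk'; case: k k' hk hk' => [|k] [|k'] hk hk'; 
  case: (redge i e) => *; congr Node; lia.
Qed.

Lemma nloc_npos n : on_belt n -> nloc (npos n) = Some n.
Proof.
move=> h; apply: opick_uniq => // n' [h' eqp]; exact: npos_inj.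
Qed.

Variant nloc_spec (p : int) : option node -> Prop :=
| NlocSome n of on_belt n & npos n = p : nloc_spec p (Some n)
| NlocNone of (forall n, on_belt n -> npos n <> p) : nloc_spec p None.

Lemma nlocP p : nloc_spec p (nloc p).
Proof.
rewrite /nloc; case: opickP => [n [hn hp]|h]; constructor => // n hn hp.
by case: (h n).
Qed.

Lemma belt_npos n : on_belt n -> belt (npos n) = npos (nxt n).
Proof. by move=> h; rewrite /belt nloc_npos. Qed.

Lemma tleb_npos n : on_belt n -> tleb (npos n) = npos (prv n).
Proof. by move=> h; rewrite /tleb nloc_npos. Qed.

Lemma blab_npos n : on_belt n -> blab (npos n) = node_label n.
Proof. by move=> h; rewrite /blab nloc_npos. Qed.

Lemma beltK : cancel belt tleb.
Proof.
move=> p; rewrite {1}/belt; case: nlocP => [n hn <-|h].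
  by rewrite tleb_npos ?nxtK //; apply: nxt_on.
by rewrite /tleb; case: nlocP => // n /h.
Qed.

Lemma tlebK : cancel tleb belt.
Proof.
move=> p; rewrite {1}/tleb; case: nlocP => [n hn <-|h].
  by rewrite belt_npos ?prvK //; apply: prv_on.
by rewrite /belt; case: nlocP => // n /h.
Qed.

Lemma belt_dom p : nloc p <> None -> nloc (belt p) <> None /\ nloc (tleb p) <> None.
Proof.
case: nlocP => // n hn <- _.
by rewrite belt_npos // tleb_npos // !nloc_npos //; [apply: prv_on | apply: nxt_on].
Qed.

Lemma belt_fix p : nloc p = None -> belt p = p /\ tleb p = p.
Proof. by rewrite /belt /tleb => ->. Qed.

(** * Travelling along a chain of edges *)

Fixpoint chain (i : int) (es : seq (seq nat)) : Prop :=
  if es is e :: es' then Ed i e /\ chain (i + (elen e)%:Z) es' else True.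

Lemma iter_belt n k : on_belt n ->
  on_belt (iter k nxt n) /\ iter k belt (npos n) = npos (iter k nxt n).
Proof.
move=> h; elim: k => //= k [h1 ->]; split; [exact: nxt_on | exact: belt_npos].
Qed.

Definition run (y : nat -> nat) (t : nat) (n : node) (k : nat) (n' : node) : Prop :=
  iter k nxt n = n' /\ forall j, (j < k)%N -> node_label (iter j nxt n) = y (t + j)%N.

Lemma run_cat y t n k n' k' n'' :
  run y t n k n' -> run y (t + k) n' k' n'' -> run y t n (k + k') n''.
Proof.
move=> [h1 h2] [h3 h4]; split; first by rewrite addnC iterD h1.
move=> j hj; case: (ltnP j k) => hjk; first exact: h2.
have -> : j = (j - k + k)%N by lia.
by rewrite iterD h1 h4; [congr y; lia | lia].
Qed.

Definition eside (sd : bool) (e : seq nat) := if sd then efwd e else ebwd e.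

Lemma run_side y t i e sd : Ed i e ->
  (forall k, (k < eside sd e)%N -> node_label (Node i e sd k) = y (t + k)%N) ->
  run y t (Node i e sd 0) (eside sd e) (nxt (Node i e sd (eside sd e).-1)).
Proof.
move=> he hy; have [ha hb _] := Ed_pos he.
have it k : (k < eside sd e)%N -> iter k nxt (Node i e sd 0) = Node i e sd k.
  elim: k => //= k IH hk; rewrite IH; last by lia.
  by move: hk; rewrite /= /eside; case: sd {IH hy} => ->.
have hs : (0 < eside sd e)%N by rewrite /eside; case: sd {hy it}.
split; first by rewrite -{1}(prednK hs) iterS it // prednK.
by move=> j hj; rewrite it // hy.
Qed.

Definition fsum (es : seq (seq nat)) : nat := sumn (map efwd es).
Definition bsum (es : seq (seq nat)) : nat := sumn (map ebwd es).

Fixpoint fwd_labels (y : nat -> nat) (t : nat) (es : seq (seq nat)) : Prop :=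
  if es is e :: es' then
    (forall k, (k < efwd e)%N -> nth 0%N e (3 + k) = y (t + k)%N) /\
    fwd_labels y (t + efwd e) es'
  else True.

(** The return cells of the edges further right are read first, hence the offset [bsum es']. *)
Fixpoint bwd_labels (y : nat -> nat) (t : nat) (es : seq (seq nat)) : Prop :=
  if es is e :: es' then
    (forall k, (k < ebwd e)%N -> nth 0%N e (3 + efwd e + k) = y (t + bsum es' + k)%N) /\
    bwd_labels y t es'
  else True.

Fixpoint last_edge (i : int) (e : seq nat) (es : seq (seq nat)) : int * seq nat :=
  if es is e' :: es' then last_edge (i + (elen e)%:Z) e' es' else (i, e).

Lemma last_edgeP i e es : chain i (e :: es) ->
  Ed (last_edge i e es).1 (last_edge i e es).2 /\
  (last_edge i e es).1 + (elen (last_edge i e es).2)%:Z = i + (eslen (e :: es))%:Z.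
Proof.
elim: es i e => [|e' es IH] i e [he hc] /=; first by split => //; rewrite /eslen /=; lia.
have [h1 h2] := IH _ _ hc; split => //; rewrite h2 /eslen /=; lia.
Qed.

Lemma run_fwd y t i e es :
  let: (i', e') := last_edge i e es in
  chain i (e :: es) -> (forall e', ~ Ed (i + (eslen (e :: es))%:Z) e') ->
  fwd_labels y t (e :: es) ->
  run y t (Node i e true 0) (fsum (e :: es)) (Node i' e' false 0).
Proof.
elim: es i e t => [|e' es IH] i e t.
  move=> /= [he _] hno [hy _]; have [ha hb _] := Ed_pos he.
  rewrite /fsum /= addn0.
  have -> : Node i e false 0 = nxt (Node i e true (efwd e).-1).
    rewrite /= prednK // ltnn /redge opick_none // => e'.
    by move: (hno e'); rewrite /eslen /= addn0.
  by apply: (run_side (sd := true)) => //= k /hy; rewrite /node_label /= addn0.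
have /= := IH (i + (elen e)%:Z) e' (t + efwd e)%N.
case: last_edge => i2 e2 IH2 [he [he' hc]] hno [hy hy'].
have [ha hb _] := Ed_pos he.
have r1 : run y t (Node i e true 0) (efwd e) (Node (i + (elen e)%:Z) e' true 0).
  have -> : Node (i + (elen e)%:Z) e' true 0 = nxt (Node i e true (efwd e).-1).
    by rewrite /= prednK // ltnn (redge_some he').
  by apply: (run_side (sd := true)) => //= k /hy; rewrite /node_label /= addn0.
apply: (run_cat r1); apply: IH2 => // e3.
by move: (hno e3); rewrite /eslen /= PoszD addrA.
Qed.

(** The return cells of the first edge are left out of the count: where the belt goes after them
    depends on what precedes the chain. *)
Lemma run_bwd y t i e es :
  let: (i', e') := last_edge i e es in
  chain i (e :: es) -> bwd_labels y t (e :: es) ->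
  run y t (Node i' e' false 0) (bsum es) (Node i e false 0).
Proof.
elim: es i e => [|e' es IH] i e; first by move=> /= *; split.
have /= := IH (i + (elen e)%:Z) e'.
case: last_edge => i2 e2 IH2 [he [he' hc]] [hy [hy' hyr]].
have [ha hb _] := Ed_pos he'.
have r1 := IH2 (conj he' hc) (conj hy' hyr).
rewrite /bsum /= addnC; apply: (run_cat r1).
have -> : Node i e false 0 = nxt (Node (i + (elen e)%:Z) e' false (ebwd e').-1).
  by rewrite /= prednK // ltnn (ledge_some he (erefl _)).
exact: (run_side (sd := false)).
Qed.

(* Forward cells left to right, then return cells right to left: one full turn around the belt of an isolated segment. *)
Lemma segment_turn y i e es :
  chain i (e :: es) -> (forall i' e', Ed i' e' -> i' + (elen e')%:Z <> i) ->
  (forall e', ~ Ed (i + (eslen (e :: es))%:Z) e') ->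
  fwd_labels y 0 (e :: es) -> bwd_labels y (fsum (e :: es)) (e :: es) ->
  [/\ iter (fsum (e :: es)) belt i = i + (eslen (e :: es))%:Z,
      iter (fsum (e :: es) + bsum (e :: es)) belt i = i &
      forall t, (t < fsum (e :: es) + bsum (e :: es))%N -> blab (iter t belt i) = y t].
Proof.
move=> hc hl hr hf hb; have [he _] := hc; have [ha hb0 _] := Ed_pos he.
have := last_edgeP hc; have := run_fwd y 0 i e es; have := run_bwd y (fsum (e :: es)) i e es.
case: last_edge => i' e' /(_ hc hb) r2 /(_ hc hr hf) r1 /= [he' hi'].
(* No edge ends at [i], so after the return cells of [e] the belt turns back to its starting
   cell. *)
have r3 : run y (fsum (e :: es) + bsum es) (Node i e false 0) (ebwd e) (Node i e true 0).
  have -> : Node i e true 0 = nxt (Node i e false (ebwd e).-1).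
    rewrite /= prednK // ltnn /ledge opick_none // => -[i2 e2] [/= h1 h2].
    exact: (hl _ _ h1 h2).
  by apply: (run_side (sd := false)) => // k; case: hb => hb _ /hb.
have := run_cat r1 (run_cat r2 r3).
have -> : (bsum es + ebwd e = bsum (e :: es))%N by rewrite /bsum /= addnC.
have on0 : on_belt (Node i e true 0) by split.
have p0 : i = npos (Node i e true 0) by rewrite /= addr0.
move=> [h1 h2]; split.
- have [_ ] := iter_belt (fsum (e :: es)) on0; rewrite -p0 => ->; case: r1 => -> _ /=.
  by rewrite /redge opick_none ?hi' // => e2; rewrite hi'; apply: hr.
- by have [_ ] := iter_belt (fsum (e :: es) + bsum (e :: es)) on0; rewrite -p0 => ->; rewrite h1.
- move=> t ht; have [h3 ] := iter_belt t on0; rewrite -p0 => ->.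
  by rewrite blab_npos // h2.
Qed.

End Conveyor.

(** * Locality and translation invariance of belts *)

Section ConveyorTransport.
Variables (Ed1 Ed2 : int -> seq nat -> Prop) (k p : int) (L : nat).
Hypothesis Ed1_pos : forall i e, Ed1 i e ->
  [/\ (0 < efwd e)%N, (0 < ebwd e)%N & (efwd e + ebwd e <= elen e)%N].
Hypothesis Ed2_pos : forall i e, Ed2 i e ->
  [/\ (0 < efwd e)%N, (0 < ebwd e)%N & (efwd e + ebwd e <= elen e)%N].
Hypothesis Ed2_sep : forall i e i' e', Ed2 i e -> Ed2 i' e' ->
  i <= i' < i + (elen e)%:Z -> i = i' /\ e = e'.
Hypothesis Ed1_len : forall i e, Ed1 i e -> (elen e <= L)%N.
Hypothesis Ed2_len : forall i e, Ed2 i e -> (elen e <= L)%N.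
Hypothesis Ed12 : forall i e, p - (3 * L)%N%:Z <= i <= p + (3 * L)%N%:Z ->
  (Ed1 i e <-> Ed2 (i + k) e).

(** An edge with a cell at [p] starts in [[p - L, p]], hence its neighbours start in
    [[p - 2L, p + L]]. Looking once more across an end from there stays within the window [3L] of
    [Ed12]. *)
Definition near_start (i : int) : Prop := p - (2 * L)%N%:Z <= i <= p + L%:Z.

Lemma redge_transport i e : near_start i -> (elen e <= L)%N ->
  redge Ed2 (i + k) e = redge Ed1 i e.
Proof.
move=> hi he; rewrite /redge; congr opick; apply: functional_extensionality => e'.
apply: propositional_extensionality; rewrite addrAC; apply: iff_sym; apply: Ed12.
by move: hi; rewrite /near_start; lia.
Qed.

Lemma ledge_transport i : near_start i ->
  ledge Ed2 (i + k) = if ledge Ed1 i is Some (i', e') then Some (i' + k, e') else None.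
Proof.
move=> hi; rewrite [in RHS]/ledge; case: opickP => [[i' e'] [/= he hi']|no].
  have hl := Ed1_len he; apply: (ledge_some Ed2_sep); last by lia.
  by apply/Ed12 => //; move: hi; rewrite /near_start; lia.
apply: opick_none => -[i' e'] [/= he hi']; have hl := Ed2_len he.
apply: (no (i' - k, e')) => /=; split; last by lia.
by apply/Ed12; rewrite ?subrK //; move: hi; rewrite /near_start; lia.
Qed.

Lemma on_transport n : near_start (nstart n) ->
  on_belt Ed1 n <-> on_belt Ed2 (node_shift k n).
Proof.
case: n => i e sd j; rewrite /near_start /on_belt /= => hi.
have h : p - (3 * L)%N%:Z <= i <= p + (3 * L)%N%:Z by lia.
by have := Ed12 e h; tauto.
Qed.

Lemma npos_transport n : near_start (nstart n) -> on_belt Ed1 n ->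
  npos Ed2 (node_shift k n) = npos Ed1 n + k.
Proof.
case: n => i e [] [|j] /= hi [/= /Ed1_len hl _]; try lia.
by rewrite redge_transport //; lia.
Qed.

Lemma nxt_transport n : near_start (nstart n) -> on_belt Ed1 n ->
  nxt Ed2 (node_shift k n) = node_shift k (nxt Ed1 n).
Proof.
case: n => i e sd j /= hi [/= /Ed1_len hl _].
rewrite redge_transport // ledge_transport //.
case: sd; case: ifP => //= _; first by case: redge => // e'; rewrite /node_shift /= addrAC.
by case: ledge => // -[].
Qed.

Lemma prv_transport n : near_start (nstart n) -> on_belt Ed1 n ->
  prv Ed2 (node_shift k n) = node_shift k (prv Ed1 n).
Proof.
case: n => i e sd [|j] //= hi [/= /Ed1_len hl _].
rewrite redge_transport // ledge_transport //.
case: sd; last by case: redge => // e'; rewrite /node_shift /= addrAC.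
by case: ledge => // -[].
Qed.

Lemma npos_start n : on_belt Ed1 n -> npos Ed1 n = p ->
  p - L%:Z <= nstart n <= p.
Proof.
move=> h hp; have hl : (elen (nedge n) <= L)%N by case: h => /Ed1_len.
by have := npos_range Ed1_pos h; rewrite hp; case => [|[]]; lia.
Qed.

Lemma nloc_transport : nloc Ed2 (p + k) = omap (node_shift k) (nloc Ed1 p).
Proof.
case: (nlocP Ed1 p) => [n hn hp|no] /=.
  have hs := npos_start hn hp.
  have hi : near_start (nstart n) by rewrite /near_start; lia.
  rewrite -hp -npos_transport //; apply: nloc_npos => //.
  exact/on_transport.
case: nlocP => // n hn hp.
have hl : (elen (nedge n) <= L)%N by case: hn => /Ed2_len.
have hs : near_start (nstart n - k).
  have := npos_range Ed2_pos hn; rewrite hp /near_start; case => [|[]]; lia.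
have [n0 en] : exists n0, n = node_shift k n0.
  exists (Node (nstart n - k) (nedge n) (nside n) (nidx n)).
  by case: {hn hp hl hs} n => i e sd j; rewrite /node_shift /= subrK.
subst n; move: hs; rewrite /= addrK => hs.
have hn0 : on_belt Ed1 n0 by apply/on_transport.
by case: (no n0 hn0); move: hp; rewrite npos_transport //; lia.
Qed.

Lemma near_nxt n : on_belt Ed1 n -> npos Ed1 n = p ->
  near_start (nstart (nxt Ed1 n)) /\ near_start (nstart (prv Ed1 n)).
Proof.
move=> h hp; have := npos_start h hp; move: h {hp}.
case: n => i e sd j [/= /Ed1_len hl _] hi.
have hL : near_start i by rewrite /near_start; lia.
have hR : near_start (i + (elen e)%:Z) by rewrite /near_start; lia.
have hM i' e' : ledge Ed1 i = Some (i', e') -> near_start i'.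
  rewrite /ledge; case: opickP => // -[i2 e2] [/= /Ed1_len h2 h3] [<- _].
  by rewrite /near_start; lia.
split.
  case: sd; case: ifP => // _; first by case: redge.
  by case: ledge hM => // -[i' e'] hM; apply: (hM i' e').
case: j => // ; case: sd; last by case: redge.
by case: ledge hM => // -[i' e'] hM; apply: (hM i' e').
Qed.

Lemma belt_transport :
  [/\ belt Ed2 (p + k) = belt Ed1 p + k, tleb Ed2 (p + k) = tleb Ed1 p + k
    & blab Ed2 (p + k) = blab Ed1 p].
Proof.
rewrite /belt /tleb /blab nloc_transport; case: (nlocP Ed1 p) => [n hn hp|no] //.
change (omap (node_shift k) (Some n)) with (Some (node_shift k n)); cbv iota beta.
have [h1 h2] := near_nxt hn hp; have hs := npos_start hn hp.
have hi : near_start (nstart n) by rewrite /near_start; lia.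
rewrite nxt_transport // prv_transport // !npos_transport //.
- exact: prv_on.
- exact: nxt_on.
Qed.

End ConveyorTransport.

(** * Codewords *)

Definition bit (q j : nat) : bool := (j < 2)%N || (j == q + 3)%N.

Lemma code_cons_ltn x l : (x < CodeSeq.code (x :: l))%N.
Proof. by have := ltn_expl x (isT : 1 < 2)%N; rewrite /=; nia. Qed.

Lemma code_cons_gtn x l : (2 * CodeSeq.code l < CodeSeq.code (x :: l))%N.
Proof. by have := expn_gt0 2 x; rewrite /=; nia. Qed.

(** Makes a codeword long enough to give each of its [a + b] cells a position of its own. Since the
    code of [x :: l] is [2 ^ x * (2 * code l + 1)], it exceeds both [x] and twice the code of
    [l]. *)
Lemma code_ge_fwd_bwd N a b l : (a + b <= CodeSeq.code [:: N, a, b & l])%N.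
Proof.
have h1 := code_cons_gtn N [:: a, b & l].
have h2 : (a + 2 * CodeSeq.code (b :: l) < CodeSeq.code [:: a, b & l])%N.
  have := ltn_expl a (isT : 1 < 2)%N; have := expn_gt0 2 a; rewrite /=; nia.
have := code_cons_ltn b l; lia.
Qed.

Lemma code_bound k n : exists L, forall l : seq nat,
  (size l <= k)%N -> all (fun x => x <= n)%N l -> (CodeSeq.code l <= L)%N.
Proof.
elim: k => [|k [L IH]]; first by exists 0%N => -[].
exists (2 ^ n * (2 * L).+1)%N => -[|x l] //= hs /andP [hx hl].
have h1 := IH l hs hl; apply: leq_mul; first by rewrite leq_exp2l.
by rewrite -mul2n ltnS leq_mul2l.
Qed.

Section Reading.
Variables (S : finType) (s1 : S).

Definition codeword_at (x : point S) (i : int) (e : seq nat) : Prop :=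
  forall j : nat, (j < elen e)%N -> (x (i + j%:Z) == s1) = bit (CodeSeq.code e) j.

(** If the codes differ, then at the place of the last 1 of the shorter codeword the longer one
    still has a 0. *)
Lemma codeword_fun x i e e' : codeword_at x i e -> codeword_at x i e' -> e = e'.
Proof.
have wl e1 e2 : codeword_at x i e1 -> codeword_at x i e2 -> ~ (CodeSeq.code e1 < CodeSeq.code e2)%N.
  move=> h1 h2 lt; have := h1 (CodeSeq.code e1 + 3)%N; have := h2 (CodeSeq.code e1 + 3)%N.
  rewrite /elen => -> ; last by lia.
  by move=> /(_ ltac:(lia)); rewrite /bit; lia.
move=> h h'; apply: (can_inj CodeSeq.codeK).
by have := wl _ _ h h'; have := wl _ _ h' h; lia.
Qed.

(** Synchronisation: inside a codeword the factor 11 occurs only at the start, and the final 0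
    prevents another 11 from straddling the end. *)
Lemma codeword_sep x i e i' e' : codeword_at x i e -> codeword_at x i' e' ->
  i <= i' < i + (elen e)%:Z -> i = i' /\ e = e'.
Proof.
move=> h h' hi; have hii : i' = i.
  have [d hd] : exists d : nat, i' = i + d%:Z by exists `|i' - i|%N; lia.
  subst i'.
  have hd : (d < CodeSeq.code e + 5)%N by move: hi; rewrite /elen; lia.
  have hb : bit (CodeSeq.code e) d.
    by rewrite -h //; have := h' 0%N; rewrite addr0 => -> //; rewrite /elen addnS.
  case: (ltnP d.+1 (CodeSeq.code e + 5)) => hd1; last by move: hb; rewrite /bit; lia.
  have hb1 : bit (CodeSeq.code e) d.+1.
    rewrite -h //; have -> : i + d.+1%:Z = i + d%:Z + 1%N%:Z by lia.
    by rewrite h' // /elen; lia.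
  by move: hb hb1; rewrite /bit; lia.
by subst i'; split => //; exact: codeword_fun h h'.
Qed.

Lemma codeword_end_bit x i e : codeword_at x i e -> x (i + (elen e)%:Z - 1) <> s1.
Proof.
move=> h; have := h (CodeSeq.code e + 4)%N; rewrite /elen => hb.
have -> : i + (CodeSeq.code e + 5)%N%:Z - 1 = i + (CodeSeq.code e + 4)%N%:Z by lia.
by apply/eqP; rewrite hb /bit; lia.
Qed.

Lemma codeword_start_bit x i e : codeword_at x i e -> x i = s1.
Proof. by move=> /(_ 0%N); rewrite addr0 => h; apply/eqP; rewrite h // /elen addnS. Qed.

Lemma codeword_transport x y k i e :
  (forall j, i <= j < i + (elen e)%:Z -> y (j + k) = x j) -> codeword_at x i e -> codeword_at y (i + k) e.
Proof. by move=> hxy h j hj; rewrite addrAC hxy ?h //; lia. Qed.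

End Reading.

(** * The topological full group *)

Lemma gmulgV (G : group) (a : G) : gmul a (ginv a) = gone G.
Proof.
rewrite -[gmul a _]gmul1 -[in LHS](gmulV (ginv a)) -gmulA (gmulA (ginv a)) gmulV gmul1.
exact: gmulV.
Qed.

Lemma gmulg1 (G : group) (a : G) : gmul a (gone G) = a.
Proof. by rewrite -(gmulV a) gmulA gmulgV gmul1. Qed.

Lemma gmul_idem (G : group) (a : G) : gmul a a = a -> a = gone G.
Proof. by move=> h; rewrite -[a]gmul1 -(gmulV a) -gmulA h. Qed.

Lemma ginv_eq (G : group) (a b : G) : gmul a b = gone G -> a = ginv b.
Proof. by move=> h; rewrite -[a]gmulg1 -(gmulgV b) gmulA h gmul1. Qed.

Lemma hom1 (G H : group) (f : G -> H) : is_hom f -> f (gone G) = gone H.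
Proof. by move=> h; apply: gmul_idem; rewrite -h gmul1. Qed.

Lemma homV (G H : group) (f : G -> H) a : is_hom f -> f (ginv a) = ginv (f a).
Proof. by move=> h; apply: ginv_eq; rewrite -h gmulV hom1. Qed.

Section Points.
Variable S : finType.

Lemma agree_le n n' (x y : point S) : (n <= n')%N -> agree n' x y -> agree n x y.
Proof. by move=> hn h i hi; apply: h; lia. Qed.

Lemma shiftD k l (x : point S) : shift k (shift l x) = shift (k + l) x.
Proof. by apply: functional_extensionality => i; rewrite /shift -addrA. Qed.

Lemma agree_shift n k (x y : point S) :
  agree (n + `|k|)%N x y -> agree n (shift k x) (shift k y).
Proof. by move=> h i hi; apply: h; lia. Qed.

(* Every cylinder contains an aperiodic point: outside the window, write [b] everywhere except for one [a]. *)
Lemma cocycle_unique (f : point S -> point S) c c' : alphabet S ->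
  is_cocycle_of f c -> is_cocycle_of f c' -> c = c'.
Proof.
move=> /card_gt1P [a [b [_ _ hab]]] [hc ec] [hc' ec'].
apply: functional_extensionality => x.
have [n hn] := hc x; have [n' hn'] := hc' x.
pose m := maxn n n'.
pose z : point S := fun i =>
  if (- m%:Z <= i <= m%:Z) then x i else if i == m%:Z + 1 then a else b.
have hz : agree m x z by move=> i hi; rewrite /z hi.
have := hn z (agree_le (leq_maxl _ _) hz); have := hn' z (agree_le (leq_maxr _ _) hz).
move=> <- <-; have e i : z (i + c z) = z (i + c' z).
  by have := ec z i; rewrite ec' /shift.
have za : z (m%:Z + 1) = a by rewrite /z ifF ?eqxx //; lia.
have zb k : 0 < k -> z (m%:Z + 1 + k) = b by move=> hk; rewrite /z ifF ?ifF //; lia.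
have aux k k' : (forall i, z (i + k) = z (i + k')) -> ~ k < k'.
  move=> h lt; have := h (m%:Z + 1 - k); rewrite subrK za.
  have -> : m%:Z + 1 - k + k' = m%:Z + 1 + (k' - k) by lia.
  by rewrite zb; [move/eqP; apply/negP | lia].
by have := aux _ _ e; have := aux _ _ (fun i => esym (e i)); lia.
Qed.

End Points.

(* The topological full group seen through its cocycles: an element permutes, equivariantly and continuously, the head positions on every tape. *)
Record tfg (S : finType) := Tfg {
  tf : point S -> int -> int;
  tv : point S -> int -> int;
  tfK : forall x, cancel (tf x) (tv x);
  tvK : forall x, cancel (tv x) (tf x);
  tf_shift : forall k x p, tf (shift k x) p = tf x (p + k) - k;
  tv_shift : forall k x p, tv (shift k x) p = tv x (p + k) - k;
  tf_cont : forall x p, exists n, forall y, agree n x y -> tf y p = tf x p;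
  tv_cont : forall x p, exists n, forall y, agree n x y -> tv y p = tv x p
}.

Section TfgGroup.
Variable S : finType.
Local Obligation Tactic := idtac.

Lemma tfg_eq (a b : tfg S) : (forall x p, tf a x p = tf b x p) -> a = b.
Proof.
move=> h.
have e1 : tf a = tf b by do 2!apply: functional_extensionality => ?.
have e2 : tv a = tv b.
  apply: functional_extensionality => x; apply: functional_extensionality => p.
  by rewrite -[p in LHS](tvK b x) -h tfK.
case: a b e1 e2 {h} => f v p1 p2 p3 p4 p5 p6 [f' v' q1 q2 q3 q4 q5 q6] /= e1 e2.
by subst f' v'; congr Tfg; apply: proof_irrelevance.
Qed.

Lemma comp_cont (h h' : point S -> int -> int) :
  (forall x p, exists n, forall y, agree n x y -> h y p = h x p) ->
  (forall x p, exists n, forall y, agree n x y -> h' y p = h' x p) ->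
  forall x p, exists n, forall y, agree n x y -> h y (h' y p) = h x (h' x p).
Proof.
move=> c c' x p; have [n' hn'] := c' x p; have [n hn] := c x (h' x p).
exists (maxn n n') => y hy.
by rewrite (hn' y (agree_le (leq_maxr _ _) hy)) (hn y (agree_le (leq_maxl _ _) hy)).
Qed.

Program Definition tfg_mul (a b : tfg S) : tfg S :=
  @Tfg S (fun x p => tf a x (tf b x p)) (fun x p => tv b x (tv a x p)) _ _ _ _ _ _.
Next Obligation. by move=> a b x p /=; rewrite !tfK. Qed.
Next Obligation. by move=> a b x p /=; rewrite !tvK. Qed.
Next Obligation. by move=> a b k x p /=; rewrite !tf_shift subrK. Qed.
Next Obligation. by move=> a b k x p /=; rewrite !tv_shift subrK. Qed.
Next Obligation. by move=> a b; exact: comp_cont (@tf_cont S a) (@tf_cont S b). Qed.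
Next Obligation. by move=> a b; exact: comp_cont (@tv_cont S b) (@tv_cont S a). Qed.

Program Definition tfg_one : tfg S := @Tfg S (fun _ p => p) (fun _ p => p) _ _ _ _ _ _.
Next Obligation. by []. Qed.
Next Obligation. by []. Qed.
Next Obligation. by move=> k x p; rewrite addrK. Qed.
Next Obligation. by move=> k x p; rewrite addrK. Qed.
Next Obligation. by move=> x p; exists 0%N. Qed.
Next Obligation. by move=> x p; exists 0%N. Qed.

Definition tfg_inv (a : tfg S) : tfg S :=
  @Tfg S (tv a) (tf a) (tvK a) (tfK a) (tv_shift a) (tf_shift a) (tv_cont a) (tf_cont a).

Program Definition tfg_group : group := @Defs.Group (tfg S) tfg_mul tfg_one tfg_inv _ _ _.
Next Obligation. by move=> a b c; apply: tfg_eq. Qed.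
Next Obligation. by move=> a; apply: tfg_eq. Qed.
Next Obligation. by move=> a; apply: tfg_eq => x p /=; rewrite tfK. Qed.

Definition tfg_map (a : tfg S) (x : point S) : point S := shift (tf a x 0) x.

Lemma tfg_map_mul a b x : tfg_map (tfg_mul a b) x = tfg_map a (tfg_map b x).
Proof. by rewrite /tfg_map shiftD tf_shift add0r subrK. Qed.

Lemma tfg_map_cont a : cont_map (tfg_map a).
Proof.
move=> x m; have [n hn] := tf_cont a x 0.
exists (maxn n (m + `|tf a x 0|)) => y hy; rewrite /tfg_map.
rewrite (hn y (agree_le (leq_maxl _ _) hy)); apply: agree_shift.
exact: agree_le (leq_maxr _ _) hy.
Qed.

Lemma tfg_map_cocycle a : is_cocycle_of (tfg_map a) (fun x => tf a x 0).
Proof. by split => // x; exact: tf_cont. Qed.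

Lemma tfg_map_in_TFG a : in_TFG (tfg_map a).
Proof.
split; last by exists (fun x => tf a x 0); apply: tfg_map_cocycle.
split; first exact: tfg_map_cont.
have one b x i : tfg_map b x = tfg_map tfg_one x -> tfg_map b x i = x i.
  by move=> ->; rewrite /tfg_map /shift addr0.
exists (tfg_map (tfg_inv a)); split; first exact: tfg_map_cont.
by split => x i; rewrite -tfg_map_mul; apply: one; congr (tfg_map _ x); 
   apply: tfg_eq => y p /=; rewrite ?tfK ?tvK.
Qed.

(** By equivariance, position [p] on [x] is position [0] on [shift p x]. *)
Lemma tf_zero_ext (a b : tfg S) :
  (fun x => tf a x 0) = (fun x => tf b x 0) -> a = b.
Proof.
move=> h; apply: tfg_eq => x p.
have := f_equal (fun F => F (shift p x)) h => /=.
by rewrite !tf_shift add0r => /(congr1 (fun q => q + p)); rewrite !subrK.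
Qed.

End TfgGroup.

(** * The action on tapes *)

(** What the construction takes from a linear plook-ahead. The last field has no additive constant:
    the displacement is a nonzero integer, so [cd] absorbs it. *)
Record cocycle_data (G : group) := CocycleData {
  ca : finType;
  ca0 : ca;
  cc : G -> point ca -> int;
  cd : nat;
  cc_cont : forall g, cont_cocycle (cc g);
  cc_mul : forall a b y, cc (gmul a b) y = cc a (shift (cc b y) y) + cc b y;
  cc_one : forall y, cc (gone G) y = 0;
  cc_moves : forall g, g <> gone G -> exists (y : point ca) (p : nat),
    [/\ (0 < p)%N, forall i, y (i + p%:Z) = y i, cc g y <> 0
      & (p <= cd * `|cc g y|)%N]
}.

Arguments cc [G] c g y.
Arguments cc_cont [G] c g x.

Lemma cocycle_data_of_plin (G : group) : in_Gplin G -> exists _ : cocycle_data G, True.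
Proof.
move=> [A [hA [phi [inT [hom [inj [alpha [[C hC] [al0 la]]]]]]]]].
have [c hc] : exists c : G -> point A -> int, forall g, is_cocycle_of (phi g) (c g).
  exists (fun g => proj1_sig (constructive_indefinite_description _ (proj2 (inT g)))).
  by move=> g; case: constructive_indefinite_description.
have cE g x : phi g x = shift (c g x) x.
  by apply: functional_extensionality => i; case: (hc g) => _ ->.
have homE a b x : phi (gmul a b) x = phi a (phi b x).
  by apply: functional_extensionality => i; rewrite hom.
have cu g c' : is_cocycle_of (phi g) c' -> c g = c' by apply: cocycle_unique.
(* [phi (gone G)] is idempotent and injective, hence the identity. *)
have id1 x : phi (gone G) x = x.
  have [[_ [h [_ [hK _]]]] _] := inT (gone G).
  apply: functional_extensionality => i.
  have hKf y : h (phi (gone G) y) = y by apply: functional_extensionality => j; rewrite hK.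
  by rewrite -[in LHS](hKf (phi _ x)) -homE gmul1 hKf.
have cone y : c (gone G) y = 0.
  rewrite (cu (gone G) (fun=> 0)) //; split=> [z|z i]; first by exists 0%N.
  by rewrite id1 /shift addr0.
have cmul a b y : c (gmul a b) y = c a (shift (c b y) y) + c b y.
  rewrite (cu (gmul a b) (fun y => c a (shift (c b y) y) + c b y)) //.
  split=> [z|z i]; last by rewrite homE !cE shiftD.
  have [n hn] := (hc b).1 z; have [m hm] := (hc a).1 (shift (c b z) z).
  exists (maxn n (m + `|c b z|)) => t ht.
  rewrite (hn t (agree_le (leq_maxl _ _) ht)); congr (_ + _); apply: hm.
  exact/agree_shift/(agree_le (leq_maxr _ _) ht).
have [a0 _] : exists a0 : A, True by move: hA => /card_gt1P [a [b _]]; exists a.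
(* With [m = |c g x| >= 1], the bounds [p <= 2n + 1] and [n <= m + Cm + C] give
   [p <= (2C + 2)m + 2C + 1 <= (4C + 3)m]. *)
unshelve eexists (@CocycleData G A a0 c (4 * C + 3) _ cmul cone _) => //.
  by move=> g; case: (hc g).
move=> g hg.
have nid : nonidentity (phi g).
  apply: NNPP => hn; apply: hg; apply: inj => x i; rewrite id1.
  by apply: NNPP => hx; apply: hn; exists x, i.
have [n [hn [x [p [hp [per hle]]]]]] := la (phi g) (ex_intro _ g erefl) nid (c g) (hc g).
(* Here the normalisation [alpha 0 = 0] is essential: it excludes a zero displacement, because
   [n >= 1]. *)
have c0 : c g x <> 0 by move=> e0; move: hle; rewrite e0 /= al0; lia.
exists x, p; split=> //; first by lia.
have hm : (0 < `|c g x|)%N by lia.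
have := hC `|c g x|%N; move: hm hle hn hp; move: (`|c g x|)%N (alpha _) => m b.
by move=> *; nia.
Qed.

Section GraphAction.
Variables (V : Type) (E : V -> V -> Prop) (f : V -> nat) (G : V -> group).
Variable d : forall u, cocycle_data (G u).
Hypothesis E_sym : forall u v, E u v -> E v u.
Hypothesis E_irr : forall u, ~ E u u.
Hypothesis f_inj : forall u v, f u = f v -> u = v.
Variables (S : finType) (s1 : S).

(** The bounds leave finitely many edges to each vertex, so the codewords of a vertex have bounded
    length. Labels are indices into the enumeration of [ca (d v)]. *)
Definition wf (v : V) (e : seq nat) : Prop :=
  [/\ size e = (3 + efwd e + ebwd e)%N, esrc e = f v,
      (0 < efwd e <= (cd (d v)).+1)%N, (0 < ebwd e <= (cd (d v)).+1)%N
    & all (fun k => k < #|ca (d v)|)%N (drop 3 e)].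

Lemma wf_pos v e : wf v e ->
  [/\ (0 < efwd e)%N, (0 < ebwd e)%N & (efwd e + ebwd e <= elen e)%N].
Proof.
move=> [sz _ /andP [-> _] /andP [-> _] _]; split=> //.
case: e sz => [|N [|a [|b l]]] //= _.
by rewrite /elen (leq_trans (code_ge_fwd_bwd N a b l)) // leq_addr.
Qed.

Lemma wf_fun u v e : wf u e -> wf v e -> u = v.
Proof. by move=> [_ h _ _ _] [_ h' _ _ _]; apply: f_inj; rewrite -h h'. Qed.

Lemma wf_bound N : exists L, forall v e, wf v e -> (f v <= N)%N -> (elen e <= L)%N.
Proof.
have one M : exists L, forall v e, wf v e -> f v = M -> (elen e <= L)%N.
  case: (classic (exists v, f v = M)) => [[v hv]|no]; last first.
    by exists 0%N => v e _ hv; case: no; exists v.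
  have [L hL] := code_bound (3 + 2 * (cd (d v)).+1) (maxn M (maxn (cd (d v)).+1 #|ca (d v)|)).
  exists (L + 5)%N => v' e h hv'; have ev : v' = v by apply: f_inj; rewrite hv'.
  subst v'; rewrite /elen leq_add2r; apply: hL; case: h => sz hs /andP [_ ha] /andP [_ hb] hl.
    by rewrite sz; lia.
  case: e sz hs ha hb hl => [|n [|a [|b l]]] //= _; rewrite /esrc /efwd /ebwd /= drop0.
  move=> hs ha hb hl; rewrite !leq_max hs hv leqnn ha hb !orbT /=.
  apply: sub_all hl => k hk; rewrite !leq_max (ltnW hk) !orbT //.
elim: N => [|N [L IH]].
  by have [L hL] := one 0%N; exists L => v e h; rewrite leqn0 => /eqP /(hL _ _ h).
have [L' hL] := one N.+1; exists (maxn L L') => v e h.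
rewrite leq_eqVlt ltnS leq_max => /orP [/eqP /(hL _ _ h) ->|/(IH _ _ h) ->] //.
by rewrite orbT.
Qed.

(* Of two commuting vertices meeting at a cell the one of larger index yields, so that only finitely many codewords have to be inspected around an edge. *)
Definition vedge (x : point S) (u : V) (i : int) (e : seq nat) : Prop :=
  [/\ codeword_at s1 x i e, wf u e &
   forall v i' e', E u v -> (f v < f u)%N -> wf v e' -> codeword_at s1 x i' e' ->
     i' + (elen e')%:Z <> i /\ i' <> i + (elen e)%:Z].

Lemma vedge_pos x u i e : vedge x u i e ->
  [/\ (0 < efwd e)%N, (0 < ebwd e)%N & (efwd e + ebwd e <= elen e)%N].
Proof. by case=> _ /wf_pos. Qed.

Lemma vedge_sep x u i e i' e' : vedge x u i e -> vedge x u i' e' ->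
  i <= i' < i + (elen e)%:Z -> i = i' /\ e = e'.
Proof. by move=> [h _ _] [h' _ _]; apply: codeword_sep h h'. Qed.

(** A codeword that could make the edge yield ends at [i] or starts at the end of the edge. All
    codewords involved have length at most [L], so it lies between [i - L] and [i + 2L]. *)
Lemma vedge_transport x y k u L i e :
  (forall v e, wf v e -> (f v <= f u)%N -> (elen e <= L)%N) ->
  (forall j, i - L%:Z <= j <= i + (2 * L)%N%:Z -> y (j + k) = x j) ->
  vedge x u i e -> vedge y u (i + k) e.
Proof.
move=> hL hxy [hm hw hv]; have le := hL _ _ hw (leqnn _); split=> //.
  by apply: codeword_transport hm => j hj; apply: hxy; lia.
move=> v i' e' huv lt hw' hm'; have le' := hL _ _ hw' (ltnW lt).
apply: NNPP => hn.
have hi : i - L%:Z <= i' - k <= i + L%:Z.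
  by apply/negP => hi; apply: hn; split; lia.
have : codeword_at s1 x (i' - k) e'.
  by apply: codeword_transport hm' => j hj; rewrite -hxy ?subrK //; lia.
by move=> /(hv v _ _ huv lt hw') [h1 h2]; apply: hn; split; lia.
Qed.

Definition vbelt (x : point S) (u : V) : int -> int := belt (vedge x u).
Definition vtleb (x : point S) (u : V) : int -> int := tleb (vedge x u).
Definition vlab (x : point S) (u : V) : int -> nat := blab (vedge x u).
Definition vpow (x : point S) (u : V) : int -> int -> int :=
  zpow (vbelt x u) (vtleb x u).

Lemma vbeltK x u : cancel (vbelt x u) (vtleb x u).
Proof. exact: beltK (@vedge_pos x u) (@vedge_sep x u). Qed.

Lemma vtlebK x u : cancel (vtleb x u) (vbelt x u).
Proof. exact: tlebK (@vedge_pos x u) (@vedge_sep x u). Qed.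

Lemma vpowD x u k l p : vpow x u (k + l) p = vpow x u k (vpow x u l p).
Proof. exact: zpowD (@vbeltK x u) (@vtlebK x u) k l p. Qed.

(** Used twice: [k = 0] gives continuity, and a tape compared with its own translate gives
    equivariance. The radius covers the edges starting within [3L] of [p] together with the
    codewords that decide about them. *)
Lemma vbelt_transport u p : exists n, forall x y k,
  (forall j, `|j| <= n%:Z -> y (j + k) = x j) ->
  [/\ vbelt y u (p + k) = vbelt x u p + k, vtleb y u (p + k) = vtleb x u p + k
    & vlab y u (p + k) = vlab x u p].
Proof.
have [L hL] := wf_bound (f u); exists (`|p| + 6 * L)%N => x y k hxy.
have hlen z i e : vedge z u i e -> (elen e <= L)%N by case=> _ /hL h _; apply: h.
apply: (belt_transport (@vedge_pos x u) (@vedge_pos y u) (@vedge_sep y u)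
  (hlen x) (hlen y)) => i e hi; split.
  by apply: vedge_transport hL _ => j hj; apply: hxy; lia.
move=> h; rewrite -[i](addrK k).
by apply: vedge_transport hL _ h => j hj; rewrite -hxy ?subrK //; lia.
Qed.

Lemma vbelt_shift x u k p :
  [/\ vbelt (shift k x) u p = vbelt x u (p + k) - k,
      vtleb (shift k x) u p = vtleb x u (p + k) - k
    & vlab (shift k x) u p = vlab x u (p + k)].
Proof.
have [n hn] := vbelt_transport u p.
by case: (hn (shift k x) x k) => // -> -> ->; rewrite !addrK.
Qed.

Lemma vpow_shift x u k j p : vpow (shift k x) u j p = vpow x u j (p + k) - k.
Proof.
rewrite /vpow; case: j => n; elim: n => /= [|n ->]; rewrite ?addrK //.
- by have [-> _ _] := vbelt_shift x u k (iter n (vbelt x u) (p + k) - k); rewrite subrK.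
- by have [_ -> _] := vbelt_shift x u k p.
- by have [_ -> _] := vbelt_shift x u k (vtleb x u (iter n (vtleb x u) (p + k)) - k); rewrite subrK.
Qed.

Lemma vbelt_cont x u p : exists n, forall y, agree n x y ->
  [/\ vbelt y u p = vbelt x u p, vtleb y u p = vtleb x u p & vlab y u p = vlab x u p].
Proof.
have [n hn] := vbelt_transport u p; exists n => y hy.
case: (hn x y 0) => [j hj|]; last by rewrite !addr0.
by rewrite addr0 hy //; lia.
Qed.

Lemma vpow_cont x u k p : exists n, forall y, agree n x y -> vpow y u k p = vpow x u k p.
Proof.
have it (g : point S -> int -> int) :
    (forall q, exists n, forall y, agree n x y -> g y q = g x q) ->
    forall m q, exists n, forall y, agree n x y -> iter m (g y) q = iter m (g x) q.
  move=> hg m q; elim: m => [|m [n hn]]; first by exists 0%N.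
  have [n' hn'] := hg (iter m (g x) q); exists (maxn n n') => y hy /=.
  by rewrite (hn y (agree_le (leq_maxl _ _) hy)) (hn' y (agree_le (leq_maxr _ _) hy)).
case: k => m; apply: it => q; have [n hn] := vbelt_cont x u q; exists n => y /hn [] //.
Qed.

Definition vread (x : point S) (u : V) (p : int) : point (ca (d u)) :=
  fun k => nth (ca0 (d u)) (enum (ca (d u))) (vlab x u (vpow x u k p)).

Definition act (u : V) (g : G u) (x : point S) (p : int) : int :=
  vpow x u (cc (d u) g (vread x u p)) p.

(** Moving along the belt shifts the word read on it. This turns the cocycle equation into the
    action law [act_mul]. *)
Lemma vread_pow x u k p : vread x u (vpow x u k p) = shift k (vread x u p).
Proof. by apply: functional_extensionality => j; rewrite /vread /shift vpowD. Qed.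

Lemma act_mul u (a b : G u) x p : act (gmul a b) x p = act a x (act b x p).
Proof. by rewrite /act cc_mul vpowD vread_pow. Qed.

Lemma act_one u x p : act (gone (G u)) x p = p.
Proof. by rewrite /act cc_one. Qed.

Lemma act_shift u (g : G u) k x p : act g (shift k x) p = act g x (p + k) - k.
Proof.
rewrite /act vpow_shift; congr (vpow _ _ (cc _ _ _) _ - _).
apply: functional_extensionality => j; rewrite /vread vpow_shift.
by have [_ _ ->] := vbelt_shift x u k (vpow x u j (p + k) - k); rewrite subrK.
Qed.

Lemma vread_cont x u p r : exists n, forall y, agree n x y ->
  agree r (vread x u p) (vread y u p).
Proof.
have one k : exists n, forall y, agree n x y -> vread x u p k = vread y u p k.
  have [n hn] := vpow_cont x u k p; have [n' hn'] := vbelt_cont x u (vpow x u k p).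
  exists (maxn n n') => y hy; rewrite /vread (hn y (agree_le (leq_maxl _ _) hy)).
  by have [_ _ ->] := hn' y (agree_le (leq_maxr _ _) hy).
elim: r => [|r [n IH]].
  have [n hn] := one 0; exists n => y hy i hi; have -> : i = 0 by lia.
  exact: hn.
have [n1 h1] := one r.+1%:Z; have [n2 h2] := one (- r.+1%:Z).
exists (maxn n (maxn n1 n2)) => y hy i hi.
have [g1 [g2 g3]] : agree n x y /\ agree n1 x y /\ agree n2 x y.
  by do !split; apply: agree_le hy; lia.
case: (eqVneq i r.+1%:Z) => [->|ne1]; first exact: h1.
case: (eqVneq i (- r.+1%:Z)) => [->|ne2]; first exact: h2.
by apply: (IH y g1); lia.
Qed.

Lemma act_cont u (g : G u) x p : exists n, forall y, agree n x y -> act g y p = act g x p.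
Proof.
have [r hr] := cc_cont (d u) g (vread x u p); have [n hn] := vread_cont x u p r.
have [m hm] := vpow_cont x u (cc (d u) g (vread x u p)) p.
exists (maxn n m) => y hy; rewrite /act hr; last exact/hn/(agree_le (leq_maxl _ _) hy).
exact/hm/(agree_le (leq_maxr _ _) hy).
Qed.

Lemma actVK u (g : G u) x : cancel (act g x) (act (ginv g) x).
Proof. by move=> p; rewrite -act_mul gmulV act_one. Qed.

Lemma actKV u (g : G u) x : cancel (act (ginv g) x) (act g x).
Proof. by move=> p; rewrite -act_mul gmulgV act_one. Qed.

Definition act_tfg (u : V) (g : G u) : tfg_group S :=
  @Tfg S (act g) (act (ginv g)) (@actVK u g) (@actKV u g)
    (@act_shift u g) (@act_shift u (ginv g)) (@act_cont u g) (@act_cont u (ginv g)).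

Lemma act_tfg_hom u : is_hom (@act_tfg u).
Proof. by move=> a b; apply: tfg_eq => x p; apply: act_mul. Qed.

Lemma act_fix u (g : G u) x p : nloc (vedge x u) p = None -> act g x p = p.
Proof. by move=> /belt_fix [h1 h2]; apply: zpow_fix. Qed.

Lemma act_dom u (g : G u) x p :
  nloc (vedge x u) p <> None -> nloc (vedge x u) (act g x p) <> None.
Proof.
move=> h; apply: (zpow_ind (Q := fun q => nloc (vedge x u) q <> None)) => // q hq;
  by have [] := belt_dom (@vedge_pos x u) (@vedge_sep x u) hq.
Qed.

(** Codewords do not overlap, so edges of [u] and [v] can share a cell only where one ends and the
    other starts. At such a junction the edge of the vertex with the larger index is not a
    [vedge]. *)
Lemma disjoint_supports u v x p : E u v ->
  nloc (vedge x u) p <> None -> nloc (vedge x v) p = None.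
Proof.
move=> huv; case: nlocP => // n hn hp _.
case: nlocP => // n' hn' hp'; exfalso.
have wl w w' m m' : E w w' -> on_belt (vedge x w) m -> on_belt (vedge x w') m' ->
    npos (vedge x w) m = npos (vedge x w') m' -> ~ nstart m <= nstart m'.
  move=> hww' hm hm' eqp lem; have hw'w := E_sym hww'.
  have r := npos_range (@vedge_pos x w) hm; have r' := npos_range (@vedge_pos x w') hm'.
  case: hm => -[h1 h2 h3] _; case: hm' => -[h1' h2' h3'] _.
  have ne : ~ nstart m' < nstart m + (elen (nedge m))%:Z.
    move=> lt; have [|_ ee] := codeword_sep h1 h1'; first by lia.
    by move: h2'; rewrite -ee => /(wf_fun h2) ew; move: hww'; rewrite ew; apply: E_irr.
  have em : nstart m' = nstart m + (elen (nedge m))%:Z by case: r; case: r'; lia.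
  case: (ltngtP (f w) (f w')) => [lt|lt|/f_inj ew].
  - by case: (h3' w _ _ hw'w lt h2 h1) => h _; apply: h; rewrite em.
  - by case: (h3 w' _ _ hww' lt h2' h1') => _ h; apply: h.
  - by move: hww'; rewrite ew; apply: E_irr.
case: (lerP (nstart n) (nstart n')) => hi.
  by apply: (wl u v n n'); rewrite // hp hp'.
by apply: (wl v u n' n (E_sym huv)) => //; [rewrite hp hp' | lia].
Qed.

Lemma act_tfg_comm : commuting_family E (Q := tfg_group S) act_tfg.
Proof.
move=> u v g h huv; apply: tfg_eq => x p /=.
case eu : (nloc (vedge x u) p) => [n|].
  have du : nloc (vedge x u) p <> None by rewrite eu.
  rewrite (act_fix h (disjoint_supports huv du)).
  by rewrite (act_fix h (disjoint_supports huv (act_dom du))).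
rewrite [act g x p]act_fix //; case ev : (nloc (vedge x v) p) => [n|].
  have dv : nloc (vedge x v) p <> None by rewrite ev.
  by rewrite act_fix //; apply: disjoint_supports (E_sym huv) (act_dom dv).
by rewrite [act h x p]act_fix // act_fix.
Qed.

(** * Belts carrying a periodic point *)

Lemma split_sum (D K N : nat) : (0 < K)%N -> (K <= N <= D * K)%N ->
  exists bs : seq nat, [/\ size bs = K, sumn bs = N & all (fun b => 0 < b <= D)%N bs].
Proof.
elim: K N => [//|[|K] IH] N _ hN.
  by exists [:: N]; split=> //=; lia.
(* Greedy choice: the first part is as large as possible while leaving at least 1 to each of the
   [K.+1] remaining parts. *)
have [||bs [h1 h2 h3]] := IH (N - minn D (N - K.+1))%N => //; first by nia.
by exists (minn D (N - K.+1) :: bs); split=> /=; rewrite ?h1 ?h2 ?h3 //; nia.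
Qed.

(** Distributes [N1] forward and [N2] return steps over as many edges as the smaller number: that
    side gets one step per edge, the other is split evenly enough by [split_sum]. *)
Lemma split_pairs (D N1 N2 : nat) : (0 < N1)%N -> (0 < N2)%N ->
  (N1 <= D * N2)%N -> (N2 <= D * N1)%N ->
  exists ab : seq (nat * nat), [/\ ab <> [::], sumn (map fst ab) = N1,
    sumn (map snd ab) = N2 & all (fun c => (0 < c.1 <= D) && (0 < c.2 <= D))%N ab].
Proof.
move=> p1 p2 h12 h21; have hD : (0 < D)%N by case: D h12 h21; lia.
have ones (bs : seq nat) : sumn [seq 1%N | _ <- bs] = size bs by elim: bs => //= b bs ->.
case: (leqP N1 N2) => hle.
  have [bs [h1 h2 h3]] := split_sum p1 (introT andP (conj hle h21)).
  exists [seq (1%N, b) | b <- bs]; rewrite -!map_comp all_map map_id; split=> //.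
  - by case: bs h1 {h2 h3} => //= h; move: p1; rewrite -h.
  - by rewrite -h1 -ones.
  - by apply: sub_all h3 => b /= ->; rewrite hD.
have [bs [h1 h2 h3]] := split_sum p2 (introT andP (conj (ltnW hle) h12)).
exists [seq (b, 1%N) | b <- bs]; rewrite -!map_comp all_map map_id; split=> //.
- by case: bs h1 {h2 h3} => //= h; move: p2; rewrite -h.
- by rewrite -h1 -ones.
- by apply: sub_all h3 => b /= ->; rewrite hD.
Qed.

(** [t] is the time at which the current forward cells are first read, [tb] the time at which the
    whole return journey begins. *)
Fixpoint mk_segment (N : nat) (y : nat -> nat) (t tb : nat) (ab : seq (nat * nat)) :
    seq (seq nat) :=
  if ab is (a, b) :: ab' then
    ([:: N, a, b & mkseq (fun k => y (t + k)%N) a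
                ++ mkseq (fun k => y (tb + sumn (map snd ab') + k)%N) b])
      :: mk_segment N y (t + a) tb ab'
  else [::].

Lemma mk_segmentP N y t tb ab :
  [/\ map efwd (mk_segment N y t tb ab) = map fst ab,
      map ebwd (mk_segment N y t tb ab) = map snd ab,
      fwd_labels y t (mk_segment N y t tb ab) &
      bwd_labels y tb (mk_segment N y t tb ab)].
Proof.
elim: ab t => [|[a b] ab IH] t //=; have [h1 h2 h3 h4] := IH (t + a)%N.
rewrite /efwd /ebwd /=; split; rewrite ?h1 ?h2 //; split=> // k hk.
  by rewrite /= nth_cat size_mkseq hk nth_mkseq.
rewrite nth_cat size_mkseq ltnNge add0n leq_addr /= addKn nth_mkseq //.
by rewrite /bsum h2.
Qed.

Lemma mk_segment_wf u y t tb ab :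
  (forall k, y k < #|ca (d u)|)%N ->
  all (fun c => (0 < c.1 <= (cd (d u)).+1) && (0 < c.2 <= (cd (d u)).+1))%N ab ->
  forall e, List.In e (mk_segment (f u) y t tb ab) -> wf u e.
Proof.
move=> hy; elim: ab t => [//|[a b] ab IH] t /= /andP [/andP [ha hb] hab] e [<-|]; last exact: IH.
split=> //=; first by rewrite size_cat !size_mkseq.
by rewrite drop0 all_cat !all_map; apply/andP; split; apply/allP => k _ /=.
Qed.

Lemma segment_exists u (g : G u) : g <> gone (G u) -> exists es,
  [/\ es <> [::], forall e, List.In e es -> wf u e &
   forall x i, chain (vedge x u) i es ->
     (forall i' e', vedge x u i' e' -> i' + (elen e')%:Z <> i) ->
     (forall e', ~ vedge x u (i + (eslen es)%:Z) e') ->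
     act g x i = i + (eslen es)%:Z].
Proof.
move=> /(cc_moves (d u)) [y [p [hp per c0 hle]]].
set c := cc (d u) g y in c0 hle.
(* [P] is the least multiple of [p] above [2|c|]. Then [P - |c|] lies between [|c|] and
   [|c| + p <= (cd + 1)|c|], which is where the bound [(cd (d v)).+1] in [wf] comes from. *)
pose q := ((2 * `|c|) %/ p).+1; pose P := (q * p)%N.
have hP : (2 * `|c| < P <= 2 * `|c| + p)%N.
  by rewrite /P /q; have := divn_eq (2 * `|c|) p; have := ltn_pmod (2 * `|c|) hp; nia.
(* [N1] is [c] modulo [P]: a full turn takes [P] steps, so a negative displacement also ends at the
   right end of the segment. *)
pose N1 := if 0 < c then `|c|%N else (P - `|c|)%N; pose N2 := (P - N1)%N.
have eN : (N1 + N2 = P)%N by rewrite /N2 /N1; case: ifP; lia.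
have hN : [/\ (0 < N1)%N, (0 < N2)%N, (N1 <= (cd (d u)).+1 * N2)%N & (N2 <= (cd (d u)).+1 * N1)%N].
  rewrite /N2 /N1; move: hP hle c0; move: (cd (d u)) => D; case: ifP => _ h1 h2 h3; split; nia.
have [p1 p2 h12 h21] := hN; have [ab [ab0 q1 q2 hab]] := split_pairs p1 p2 h12 h21.
pose yn k := index (y (Posz k)) (enum (ca (d u))).
have hyn k : (yn k < #|ca (d u)|)%N by rewrite cardE index_mem mem_enum.
exists (mk_segment (f u) yn 0 N1 ab); split.
- by case: ab ab0 {q1 q2 hab} => [|[]].
- exact: mk_segment_wf.
move=> x i; have [e1 e2 e3 e4] := mk_segmentP (f u) yn 0 N1 ab.
have f1 : fsum (mk_segment (f u) yn 0 N1 ab) = N1 by rewrite /fsum e1 q1.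
have f2 : bsum (mk_segment (f u) yn 0 N1 ab) = N2 by rewrite /bsum e2 q2.
move: f1 f2 e3 e4; case: mk_segment => [|e es]; first by move=> h; move: p1; rewrite -h.
move=> f1 f2 e3 e4 hc hl hr; rewrite -f1 in e4.
have [t1 t2 t3] := segment_turn (@vedge_pos x u) (@vedge_sep x u) hc hl hr e3 e4.
rewrite f1 f2 eN in t1 t2 t3.
have perP z (k : int) : y (z + k * P%:Z) = y z.
  have per1 (m : nat) w : y (w + m%:Z * p%:Z) = y w.
    elim: m w => [|m IH] w; first by rewrite mul0r addr0.
    by rewrite intS mulrDl mul1r addrA IH per.
  have -> : k * P%:Z = (k * q%:Z) * p%:Z by rewrite -mulrA /P PoszM.
  case: (k * q%:Z) => m; first exact: per1.
  by rewrite -(per1 m.+1) NegzE mulNr subrK.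
have zP k : vpow x u (k * P%:Z) i = i.
  exact: (zpow_period (@vbeltK x u) (@vtlebK x u)).
have hread : vread x u i = y.
  apply: functional_extensionality => k; rewrite /vread.
  (* Both the belt through [i] and [y] have period [P], so it suffices to compare them at the times
     of one turn. *)
  have hP0 : P%:Z != 0 by lia.
  rewrite (intdiv.divz_eq k P%:Z) addrC vpowD zP.
  have : 0 <= intdiv.modz k P%:Z < P%:Z.
    by rewrite intdiv.modz_ge0 //= intdiv.ltz_pmod //; lia.
  rewrite perP; case: intdiv.modz => // t ht.
  rewrite [vpow _ _ _ _]/= /vlab t3; last by lia.
  by rewrite nth_index // mem_enum.
rewrite /act hread -/c.
(* [c] is [N1] or [N1 - P], and the missing full turn is trivial. *)
have -> : c = N1%:Z + (if 0 < c then 0 else -1) * P%:Z.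
  by rewrite /N1; case: ifP => hc0; lia.
by rewrite vpowD zP.
Qed.

(** * Tapes crossed by reduced words *)

(** The letter after the last codeword differs from [s1], so that no codeword starts there. *)
Fixpoint reads (x : point S) (i : int) (es : seq (seq nat)) : Prop :=
  if es is e :: es' then codeword_at s1 x i e /\ reads x (i + (elen e)%:Z) es' else x i <> s1.

Lemma eslen_cat A B : eslen (A ++ B) = (eslen A + eslen B)%N.
Proof. by rewrite /eslen map_cat sumn_cat. Qed.

Lemma reads_agree x y i es : (forall j, i <= j <= i + (eslen es)%:Z -> y j = x j) ->
  reads x i es -> reads y i es.
Proof.
elim: es i => [|e es IH] i h /=; first by rewrite h //=; lia.
move: h; rewrite /eslen /= -/(eslen es) => h [h1 h2]; split.
  rewrite -[i]addr0; apply: codeword_transport h1 => j hj; rewrite addr0 h //; lia.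
by apply: IH h2 => j hj; apply: h; lia.
Qed.

Lemma tape_exists (s0 : S) es i : s0 <> s1 ->
  exists x, (forall j, j < i -> x j = s1) /\ reads x i es.
Proof.
move=> /eqP/negbTE s01; elim: es i => [|e es IH] i.
  exists (fun j => if j < i then s1 else s0); split=> [j ->//|] /=.
  by rewrite ltxx; move/eqP: s01.
have [x [_ hx]] := IH (i + (elen e)%:Z).
exists (fun j => if j < i then s1 else if j < i + (elen e)%:Z then
          if bit (CodeSeq.code e) `|j - i|%N then s1 else s0 else x j).
split=> [j ->//|]; split.
  move=> j hj; have -> : (i + j%:Z < i) = false by lia.
  have -> : (i + j%:Z < i + (elen e)%:Z) by lia.
  have -> : `|(i + j%:Z - i)%R|%N = j by lia.
  by case: bit; rewrite ?eqxx.
apply: reads_agree hx => j hj; have -> : (j < i) = false by lia.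
by have -> : (j < i + (elen e)%:Z) = false by lia.
Qed.

Lemma reads_cat x i A B : reads x i (A ++ B) -> reads x (i + (eslen A)%:Z) B.
Proof.
elim: A i => [|e A IH] i /=; first by rewrite addr0.
by move=> [_ /IH]; rewrite /eslen /= PoszD addrA.
Qed.

(** If [A] were empty, the codeword would end at [i - 1]; but its final letter is not [s1], whereas
    [x (i - 1) = s1]. *)
Lemma reads_left x i A B i' e' : x (i - 1) = s1 -> reads x i (A ++ B) ->
  codeword_at s1 x i' e' -> i' + (elen e')%:Z = i + (eslen A)%:Z -> exists A', A = rcons A' e'.
Proof.
move=> hx hr hm; case: (lastP A) hr => [|A' e] hr he.
  by case: (codeword_end_bit hm); rewrite he addr0.
exists A'; congr (rcons _ _); move: hr; rewrite cat_rcons => /reads_cat [hm' _].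
have sep := fun i e i' e' => @codeword_sep S s1 x i e i' e'.
case: (Ed_end_fun sep hm' hm) => //.
by rewrite he -cats1 eslen_cat /eslen /= addn0; lia.
Qed.

Lemma reads_right x i A B e' : reads x i (A ++ B) -> codeword_at s1 x (i + (eslen A)%:Z) e' ->
  exists B', B = e' :: B'.
Proof.
move=> /reads_cat; case: B => [|e B] /=; first by move=> h /codeword_start_bit.
by move=> [h _] /(codeword_fun h) ->; exists B.
Qed.

Fixpoint admissible (es : seq (seq nat)) : Prop :=
  if es is e :: es' then
    [/\ exists v, wf v e,
        if es' is e' :: _ then forall v v', wf v e -> wf v' e' -> ~ E v v' else True
      & admissible es']
  else True.

Lemma admissible_cat A B : admissible (A ++ B) -> admissible B.
Proof. by elim: A => //= e A IH [_ _ /IH]. Qed.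

Lemma admissible_next A e e' B v v' :
  admissible (A ++ [:: e, e' & B]) -> wf v e -> wf v' e' -> ~ E v v'.
Proof. by move=> /admissible_cat [_ h _]; apply: h. Qed.

(** No edge of an admissible list yields: a codeword touching it is its neighbour in the list, and
    the vertices of neighbours are not adjacent in the graph. *)
Lemma reads_vedge x i A e B v : x (i - 1) = s1 -> admissible (A ++ e :: B) ->
  reads x i (A ++ e :: B) -> wf v e -> vedge x v (i + (eslen A)%:Z) e.
Proof.
move=> hx ha hr hw; have [hm _] := reads_cat hr; split=> // v' i' e' hE _ hw' hm'; split.
  move=> he; have [A' eA] := reads_left hx hr hm' he.
  by move: ha; rewrite eA cat_rcons => /admissible_next /(_ hw' hw); apply; apply: E_sym.
move=> ei; have hr' : reads x i ((A ++ [:: e]) ++ B) by rewrite -catA.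
have [|B' eB] := reads_right (e' := e') hr'.
  by rewrite eslen_cat {2}/eslen /= addn0 PoszD addrA -ei.
by move: ha; rewrite eB => /admissible_next /(_ hw hw'); apply.
Qed.

Lemma reads_chain x i A es B u : x (i - 1) = s1 -> admissible (A ++ es ++ B) ->
  reads x i (A ++ es ++ B) -> (forall e, List.In e es -> wf u e) ->
  chain (vedge x u) (i + (eslen A)%:Z) es.
Proof.
move=> hx; elim: es A => [//|e es IH] A ha hr hw.
split; first by apply: (reads_vedge hx ha hr); apply: hw; left.
have := IH (rcons A e); rewrite cat_rcons => /(_ ha hr).
rewrite -cats1 eslen_cat {2}/eslen /= addn0 PoszD addrA; apply.
by move=> e' he'; apply: hw; right.
Qed.

(** Expresses that no letter of [v] can be brought to the front of [w] by commutations: the scan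
    passes the letters adjacent to [v] and stops at the first other one, which must not belong to
    [v]. *)
Fixpoint nohit (v : V) (w : seq {u : V & G u}) : Prop :=
  if w is l :: w' then projT1 l <> v /\ (E (projT1 l) v -> nohit v w') else True.

Fixpoint reduced (w : seq {u : V & G u}) : Prop :=
  if w is l :: w' then
    [/\ projT2 l <> gone (G (projT1 l)), nohit (projT1 l) w' & reduced w']
  else True.

Definition actw (w : seq {u : V & G u}) (x : point S) (p : int) : int :=
  foldr (fun l => act (projT2 l) x) p w.

Lemma admissible_segment u es B : (forall e, List.In e es -> wf u e) -> admissible B ->
  (forall b B' v, B = b :: B' -> wf v b -> ~ E u v) -> admissible (es ++ B).
Proof.
move=> hw hB hn; elim: es hw => [//|e es IH] hw.
have we : wf u e by apply: hw; left.
split; first by exists u.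
  case: es hw {IH} => [|e' es] hw /=.
    by case: B hn {hB} => // b B hn v v' /(wf_fun we) <-; apply: hn.
  move=> v v' /(wf_fun we) <-; have /wf_fun h : wf u e' by apply: hw; right; left.
  by move=> /h <-; apply: E_irr.
by apply: IH => e' he'; apply: hw; right.
Qed.

(* The tape is written from right to left, reading the word from its last acting letter: a letter commuting with the vertex [v] whose belt starts at the current end leaves the head there, any other one contributes a belt in front, which carries the head from its left end to its right end. *)
Lemma chain_tape w B : reduced w -> admissible B ->
  (forall b B' v, B = b :: B' -> wf v b -> nohit v w) ->
  exists A, [/\ admissible (A ++ B),
    forall A' e b B' v, A = rcons A' e -> B = b :: B' -> wf v e -> ~ wf v b,
    B = [::] -> w <> [::] -> A <> [::] &
    forall x, x (-1) = s1 -> reads x 0 (A ++ B) -> actw w x 0 = (eslen A)%:Z].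
Proof.
elim: w B => [|[u g] w IH] B; first by exists [::]; split=> // -[].
move=> [hg hu hw] hB hn; rewrite /= in hg hu hn.
(* Either [u] is adjacent to the vertex of the first edge of [B], and [g] should do nothing, or a
   belt for [g] is written in front of [B]. *)
case: (classic (exists b B' v, [/\ B = b :: B', wf v b & E u v])) => [[b [B' [v [eB hb huv]]]]|no].
  have [huv' hv] := hn _ _ _ eB hb.
  have [|||A [h1 h2 h3 h4]] := IH B => //.
    by move=> b2 B2 v2; rewrite eB => -[<- _] /(wf_fun hb) <-; apply: hv.
  exists A; split=> //; first by rewrite eB.
  move=> x hx hr; rewrite /= h4 //; apply: act_fix.
  (* A belt of [u] through the start of [b] would use [b] itself, which belongs to another vertex,
     or an edge ending there; the latter is the last one of [A] and cannot precede [b] in an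
     admissible list. *)
  case: nlocP => // n hon hp; exfalso.
  have := npos_range (@vedge_pos x u) hon; rewrite hp.
  case: hon => -[hm hwn _] _; move: hr h1; rewrite eB => hr h1.
  have [hmb _] := reads_cat hr; rewrite add0r in hmb.
  case=> [r|[he _]].
    by case: (codeword_sep hm hmb r) => _ en; apply: huv'; apply: wf_fun hb; rewrite -en.
  have [||A' eA] := reads_left (i := 0) _ hr hm; rewrite ?add0r //.
  by move: h1; rewrite eA cat_rcons => /admissible_next /(_ hwn hb); apply.
have [es [es0 hes hact]] := segment_exists hg.
have hnu b B' v : B = b :: B' -> wf v b -> ~ E u v.
  by move=> eB hb huv; apply: no; exists b, B', v.
(* The new front edge belongs to [u], and [nohit u w] from reducedness restores the hypothesis on
   the remaining word. *)
have [||A [h1 h2 h3 h4]] := IH (es ++ B) hw.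
- exact: (admissible_segment hes hB hnu).
- case: es es0 hes {hact} => // e es _ hes b B' v [<- _].
  by move=> /wf_fun h; rewrite (h u) //; apply: hes; left.
have last_es A' e : A ++ es = rcons A' e -> wf u e.
  case/lastP: es es0 hes {hact h1 h2 h3 h4} => // es e' _ hes.
  rewrite -rcons_cat => /rcons_inj [_ <-]; apply: hes.
  by rewrite -cats1; apply/List.in_app_iff; right; left.
exists (A ++ es); rewrite -catA; split=> //.
- move=> A' e b B' v /last_es he eB /(wf_fun he) <- hb.
  by case: (hn _ _ _ eB hb) => /=.
- by move=> _ _; case: (A) => //; case: es es0 {hes hact h1 h2 h3 h4 last_es}.
move=> x hx hr; rewrite /= h4 // hact ?eslen_cat ?PoszD //.
- by rewrite -[X in chain _ X]add0r; apply: reads_chain h1 hr hes; rewrite add0r.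
(* The belt turns at its left end: an edge of [u] ending there would be the last one of [A], against
   the second clause of the induction hypothesis. *)
- move=> i' e' [hm hwe _] he.
  have [||A' eA] := reads_left (i := 0) _ hr hm; rewrite ?add0r //.
  case: es es0 hes h2 {hact hr h1 h3 h4 last_es} => // e es _ hes h2.
  by apply: (h2 A' e' e (es ++ B) u) => //; apply: hes; left.
(* It turns at its right end too: an edge of [u] starting there would be the first one of [B],
   against the hypothesis on [u :: w]. *)
- move=> e' [hm hwe _]; move: hr; rewrite catA => /reads_right.
  rewrite eslen_cat add0r PoszD => /(_ _ hm) [B' eB].
  by case: (hn _ _ _ eB hwe).
Qed.

Lemma reduced_moves (s0 : S) w : s0 <> s1 -> reduced w -> w <> [::] ->
  exists (M : nat) (x : point S), (0 < M)%N /\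
    forall y, agree M x y -> actw w y 0 = M%:Z.
Proof.
move=> s01 hw w0; have [//|//|A [h1 _ h3 h4]] := chain_tape (B := [::]) hw.
rewrite cats0 in h1 h4; have [x [hx hr]] := tape_exists A 0 s01.
exists (eslen A), x; split.
  case: A h3 {h1 h4 hr} => [|e A] h; first by case: h.
  by rewrite /eslen /= addn_gt0 elen_gt0.
(* Positivity puts position [-1], where [s1] is required, inside the window of radius [eslen A]. *)
have M0 : (0 < eslen A)%N.
  case: A h3 {h1 h4 hr} => [|e A] h; first by case: h.
  by rewrite /eslen /= addn_gt0 elen_gt0.
move=> y hy; apply: h4; first by rewrite -hy ?hx //; lia.
by apply: reads_agree hr => j hj; rewrite -hy //; lia.
Qed.

End GraphAction.

(** * Words of the graph product *)

Section Words.
Variables (V : Type) (E : V -> V -> Prop) (G : V -> group) (P : group).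
Variable iota : forall u, G u -> P.
Hypothesis iota_hom : forall u, is_hom (@iota u).
Hypothesis iota_comm : commuting_family E iota.

Definition weval (w : seq {u : V & G u}) : P :=
  foldr (fun l p => gmul (iota (projT2 l)) p) (gone P) w.

Lemma weval_cat w w' : weval (w ++ w') = gmul (weval w) (weval w').
Proof. by elim: w => /= [|l w ->]; rewrite ?gmul1 ?gmulA. Qed.

Lemma weval_inv w : exists w', weval w' = ginv (weval w).
Proof.
elim: w => [|[u g] w [w' h]]; first by exists [::]; apply: ginv_eq; rewrite gmul1.
exists (w' ++ [:: existT _ u (ginv g)]); apply: ginv_eq.
rewrite weval_cat /= gmulg1 h homV // -gmulA (gmulA (ginv (iota g))) gmulV gmul1.
exact: gmulV.
Qed.

(** A letter of [u] that can be commuted to the front of [w] is merged with [g], which saves one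
    letter. *)
Lemma not_nohit_shorten u (g : G u) w : ~ nohit E u w ->
  exists w', size w' = size w /\ weval w' = weval (existT _ u g :: w).
Proof.
elim: w => [[] //|[v h] w IH /=] hn.
case: (classic (v = u)) => [ev|nv].
  subst v; exists (existT _ u (gmul g h) :: w); split=> //=.
  by rewrite (iota_hom g h) gmulA.
case: (classic (E v u)) => [hE|nE]; last by case: hn.
have [hit|w' [h1 h2]] := IH; first by apply: hn; split.
exists (existT _ v h :: w'); split; first by rewrite /= h1.
by rewrite /= h2 /= !gmulA (iota_comm _ _ hE).
Qed.

Lemma not_reduced_shorten w : ~ reduced E w ->
  exists w', (size w' < size w)%N /\ weval w' = weval w.
Proof.
elim: w => [[] //|[u g] w IH /=] hn.
case: (classic (g = gone (G u))) => [-> |hg].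
  by exists w; split=> //=; rewrite hom1 // gmul1.
case: (classic (nohit E u w)) => [hu|/(not_nohit_shorten g) [w' [h1 h2]]].
  have [hr|w' [h1 h2]] := IH; first by apply: hn.
  by exists (existT _ u g :: w'); split=> //=; rewrite h2.
by exists w'; rewrite h1.
Qed.

Lemma reduced_word w : exists w', reduced E w' /\ weval w' = weval w.
Proof.
have [n] := ubnP (size w); elim: n w => // n IH w hs.
case: (classic (reduced E w)) => [h|/not_reduced_shorten [w' [h1 h2]]]; first by exists w.
by rewrite -h2; apply: IH; apply: leq_trans h1 _.
Qed.

End Words.

Section WordSubgroup.
Variables (V : Type) (G : V -> group) (P : group) (iota : forall u, G u -> P).
Hypothesis iota_hom : forall u, is_hom (@iota u).
Local Obligation Tactic := idtac.

Definition word_carrier : Type := {p : P | exists w, weval iota w = p}.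

Lemma word_carrier_eq (a b : word_carrier) : sval a = sval b -> a = b.
Proof.
case: a b => a ha [b hb] /= e; subst b; congr exist; exact: proof_irrelevance.
Qed.

Program Definition word_mul (a b : word_carrier) : word_carrier :=
  exist _ (gmul (sval a) (sval b)) _.
Next Obligation. by move=> [a [w ha]] [b [w' hb]]; exists (w ++ w'); rewrite weval_cat ha hb. Qed.

Program Definition word_inv (a : word_carrier) : word_carrier :=
  exist _ (ginv (sval a)) _.
Next Obligation. by move=> [a [w ha]]; rewrite /= -ha; apply: weval_inv. Qed.

Program Definition word_group : group :=
  @Defs.Group word_carrier word_mul (exist _ (gone P) _) word_inv _ _ _.
Next Obligation. by exists [::]. Qed.
Next Obligation. by move=> a b c; apply: word_carrier_eq; apply: gmulA. Qed.
Next Obligation. by move=> a; apply: word_carrier_eq; apply: gmul1. Qed.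
Next Obligation. by move=> a; apply: word_carrier_eq; apply: gmulV. Qed.

Definition word_letter u (g : G u) : word_group :=
  exist _ (iota g) (ex_intro _ [:: existT _ u g] (gmulg1 (iota g))).

End WordSubgroup.

(** The universal property gives a map from [P] to the subgroup of values of words. Followed by the
    inclusion it agrees with the identity on every [iota u g], hence everywhere by uniqueness. *)
Lemma graph_product_generated (V : Type) (E : V -> V -> Prop) (G : V -> group)
    (P : group) (iota : forall u, G u -> P) :
  is_graph_product V E G P iota -> forall p, exists w, weval iota w = p.
Proof.
move=> [hom [comm univ]] p.
have [|u v g h huv|[F [hF Fi]] _] := univ (word_group hom) (word_letter hom).
- by move=> u a b; apply: word_carrier_eq; apply: hom.
- by apply: word_carrier_eq; apply: comm.
have [_ uniq] := univ P iota hom comm.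
have -> : p = sval (F p).
  apply: (uniq (fun q => q) (fun q => sval (F q))) => // [a b|u g]; first by rewrite hF.
  by rewrite Fi.
exact: proj2_sig (F p).
Qed.

(** * The embedding with look-ahead zero *)

Lemma embeds_with_zero_lookahead (V : Type) (E : V -> V -> Prop) (G : V -> group)
    (P : group) (iota : forall u, G u -> P) (S : finType) (A : (nat -> nat) -> Prop) :
  simple_graph E -> countable_type V -> (forall u, in_Gplin (G u)) ->
  is_graph_product V E G P iota -> alphabet S -> A (fun=> 0%N) ->
  embeds_with P (@has_lookahead S) A.
Proof.
move=> [E_sym E_irr] [f f_inj] plin gp hS hA.
pose d u := proj1_sig (constructive_indefinite_description _ (cocycle_data_of_plin (plin u))).
have [s0 [s1 [_ _ /eqP s01]]] := card_gt1P hS.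
have [hom [comm univ]] := gp.
have [[F [hF Fi]] _] := univ (tfg_group S) (act_tfg E d f_inj s1)
  (fun u => act_tfg_hom (u := u) E d f_inj s1) (act_tfg_comm d E_sym E_irr f_inj s1).
have Fw w x p : tf (F (weval iota w)) x p = actw E f d s1 w x p.
  elim: w p => [|[u g] w IH] p /=; first by rewrite hom1.
  by rewrite hF /= Fi /= IH.
have moves p : p <> gone P -> exists (M : nat) (x : point S), (0 < M)%N /\
    forall y, agree M x y -> tf (F p) y 0 = M%:Z.
  move=> hp; have [w ew] := graph_product_generated gp p.
  have [w' [hr ew']] := reduced_word hom comm w.
  have [|M [x [M0 hM]]] := reduced_moves d E_sym E_irr f_inj s01 hr.
    by move=> w0; apply: hp; rewrite -ew -ew' w0.
  by exists M, x; split=> // y hy; rewrite -ew -ew' Fw; apply: hM.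
(* Look-ahead speaks of every cocycle of the map; over an alphabet there is only this one. *)
have cu g c : is_cocycle_of (tfg_map (F g)) c -> c = fun x => tf (F g) x 0.
  by move=> hc; apply: cocycle_unique hS hc (tfg_map_cocycle _).
exists (fun p => tfg_map (F p)); split; first by move=> g; apply: tfg_map_in_TFG.
split; first by move=> a b x i; rewrite hF tfg_map_mul.
split.
  move=> a b hab.
  have Fab : F a = F b.
    apply: tf_zero_ext; apply: cu.
    have [h1 h2] := tfg_map_cocycle (F a); split=> // x i; by rewrite -hab.
  (* Otherwise the image of the quotient would move the head by a positive amount, although it is
     the identity. *)
  have h1 : gmul (ginv a) b = gone P.
    apply: NNPP => /moves [M [x [M0 hM]]].
    have := hM x (fun _ _ => erefl); rewrite hF (homV _ hF) Fab /= tfK.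
    by lia.
  by rewrite -[a]gmulg1 -h1 gmulA gmulgV gmul1.
exists (fun=> 0%N); split=> //; split=> // _ [g ->] [x0 [i0 hx0]] c hc.
have hg : g <> gone P.
  by move=> eg; apply: hx0; rewrite eg hom1 // /tfg_map /shift /= addr0.
have [M [x [M0 hM]]] := moves g hg; exists M; split=> //.
(* The cylinder is the window of radius [M] of the tape, and the displacement equals this radius, so
   [alpha] may vanish. *)
exists [tuple x (- M%:Z + (j : nat)%:Z) | j < (2 * M + 1)%N], M%:Z; split; last first.
  by rewrite addn0.
move=> y hy; rewrite (cu g c hc); apply: hM => i hi.
have hj : (`|(i + M%:Z)%R| < 2 * M + 1)%N by lia.
have := hy (Ordinal hj); rewrite tnth_mktuple /=.
by have -> : - M%:Z + `|(i + M%:Z)%R|%N%:Z = i by lia.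
Qed.

Theorem mainTheorem6 (V : Type) (E : V -> V -> Prop) (G : V -> group)
  (P : group) (iota : forall u, G u -> P) :
  simple_graph E -> countable_type V ->
  (forall u, in_Gplin (G u)) ->
  is_graph_product V E G P iota ->
  (forall S : finType, alphabet S -> in_Gbnd S P) /\
  (forall S : finType, alphabet S -> embeds_with P (@has_lookahead S) linear_fun) /\
  (finite_type V -> forall S : finType, alphabet S ->
     embeds_with P (@has_lookahead S) bounded_fun).
Proof.
move=> hE hV hG hP; split; last split=> [S hS|_ S hS].
- by move=> S hS; apply: embeds_with_zero_lookahead hE hV hG hP hS _; exists 0%N.
- by apply: embeds_with_zero_lookahead hE hV hG hP hS _; exists 0%N.
- by apply: embeds_with_zero_lookahead hE hV hG hP hS _; exists 0%N.
Qed.
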